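(* Let $G$ be a second countable locally compact group, with a fixed right-invariant compatible metric $d$. Let $(X,\mathcal{B},G)$ be a Borel system. Then there exists an injective $G$-equivariant Borel map $\Phi:X\to \mathrm{Lip}_1(G)$.
   Context: A metric $d$ on $G$ is compatible if it induces the topology of $G$, and right-invariant if $d(hg,h'g)=d(h,h')$ for all $h,h',g\in G$ (such a metric exists on every second countable locally compact group). $\mathrm{Lip}_1(G)$ denotes the compact space of functions $f:G\to[0,1]$ with $|f(g)-f(h)|\le d(g,h)$ for all $g,h\in G$, equipped with the compact-open topology (and its Borel $\sigma$-algebra). The group $G$ acts continuously on $\mathrm{Lip}_1(G)$ by the right argument shift $(gf)(h)=f(hg)$ for $g,h\in G$, $f\in \mathrm{Lip}_1(G)$. A Borel system is a triple $(X,\mathcal{B},G)$, where $(X,\mathcal{B})$ is a standard Borel space and $G$ is a second countable locally compact group equipped with an action $G\times X\to X$, $(g,x)\mapsto gx$ (so $ex=x$ and $(gh)x=g(hx)$), which is a Borel map. Neither freeness nor the existence of an invariant measure is assumed. A map $\Phi$ is $G$-equivariant if $\Phi(gx)=g\Phi(x)$ for all $g\in G$, $x\in X$. *)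

(* Defs.v *)
From HB Require Import structures.
From mathcomp Require Import all_boot all_order all_algebra.
From mathcomp Require Import all_classical all_reals all_analysis.

Set Implicit Arguments.
Unset Strict Implicit.
Unset Printing Implicit Defensive.

Import Order.TTheory GRing.Theory Num.Theory.
Import numFieldTopology.Exports.

Local Open Scope classical_set_scope.
Local Open Scope ring_scope.

HB.structure Definition PreTopologicalGroup :=
  {G of Topological G & Group G}.

HB.mixin Record PreTopologicalGroup_isTopologicalGroup G
    & PreTopologicalGroup G := {
  mulg_continuous : continuous (fun p : G * G => (p.1 * p.2)%g) ;
  invg_continuous : continuous (fun g : G => (g^-1)%g)
}.

#[short(type="topologicalGroupType")]
HB.structure Definition TopologicalGroup :=
  {G of PreTopologicalGroup G & PreTopologicalGroup_isTopologicalGroup G}.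

Section Metrics.
Context {R : realType}.

Record is_metric {T : Type} (d : T -> T -> R) : Prop := {
  metric_eq0 : forall x y, d x y = 0 <-> x = y ;
  metric_symmetric : forall x y, d x y = d y x ;
  metric_triangular : forall x y z, d x z <= d x y + d y z
}.

Definition compatible_metric {T : topologicalType} (d : T -> T -> R) : Prop :=
  is_metric d /\
  forall A : set T, open A <->
    forall x, A x -> exists2 e, 0 < e & [set y | d x y < e] `<=` A.

Definition complete_metric {T : Type} (d : T -> T -> R) : Prop :=
  forall u : nat -> T,
    (forall e, 0 < e -> exists N, forall m n,
       (N <= m)%N -> (N <= n)%N -> d (u m) (u n) < e) ->
    exists l, forall e, 0 < e -> exists N, forall n,
       (N <= n)%N -> d (u n) l < e.

Definition right_invariant {G : groupType} (d : G -> G -> R) : Prop :=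
  forall h h' g : G, d (h * g)%g (h' * g)%g = d h h'.

End Metrics.

Definition polish (R : realType) (T : topologicalType) : Prop :=
  (exists2 D : set T, countable D & dense D) /\
  exists d : T -> T -> R, compatible_metric d /\ complete_metric d.

(* Sigma-algebras are kept as set systems, since [measurableType] is pointed
   and would exclude the empty space. *)
Definition borel (T : topologicalType) : set (set T) := <<s @open T >>.

Definition product_sigma {T U : Type} (A : set (set T)) (B : set (set U)) :
  set (set (T * U)) := <<s [set C `*` D | C in A & D in B] >>.

Definition measurable_map {T U : Type} (A : set (set T)) (B : set (set U))
  (f : T -> U) : Prop := forall C, B C -> A (f @^-1` C).

(* [(X, B)] is isomorphic to a Polish space with its Borel sets; in particular
   [B] is a sigma-algebra. *)
Definition standard_borel (R : realType) {X : Type} (B : set (set X)) : Prop :=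
  exists (T : topologicalType) (phi : X -> T),
    [/\ polish R T, bijective phi &
        B = preimage_set_system setT phi (@borel T)].

Record borel_system (R : realType) (G : topologicalGroupType) {X : Type}
    (B : set (set X)) (act : G -> X -> X) : Prop := {
  bs_standard : standard_borel R B ;
  bs_act1 : forall x, act 1%g x = x ;
  bs_actM : forall g h x, act (g * h)%g x = act g (act h x) ;
  bs_measurable :
    measurable_map (product_sigma (@borel G) B) B (fun p => act p.1 p.2)
}.

Section Lip1.
Context {R : realType} {G : topologicalGroupType}.

(* The type [set_type (Lip1 d)] carries the subspace topology inherited from
   the compact-open topology on all functions. *)
Definition Lip1 (d : G -> G -> R) : set {compact-open, G -> R} :=
  [set f : G -> R | (forall g, 0 <= f g <= 1) /\
                    (forall g h, `|f g - f h| <= d g h)].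

Definition rshift (g : G) (f : {compact-open, G -> R}) :
  {compact-open, G -> R} := fun h => f (h * g)%g.

Lemma Lip1_rshift (d : G -> G -> R) : right_invariant d ->
  forall g f, f \in Lip1 d -> rshift g f \in Lip1 d.
Proof.
move=> dr g f /set_mem[f01 fd]; apply/mem_set; split=> [h|h k].
  exact: f01.
by rewrite -(dr h k g); exact: fd.
Qed.

Definition Lip1_act (d : G -> G -> R) (dr : right_invariant d) (g : G)
    (f : set_type (Lip1 d)) : set_type (Lip1 d) :=
  SigSub (Lip1_rshift dr g (valP f)).

End Lip1.

Definition equivariant {G X Y : Type} (actX : G -> X -> X) (actY : G -> Y -> Y)
  (Phi : X -> Y) : Prop := forall g x, Phi (actX g x) = actY g (Phi x).

(* Main.v *)
Require Import Defs.
From HB Require Import structures.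
From mathcomp Require Import all_boot all_order all_algebra.
From mathcomp Require Import all_classical all_reals all_analysis.
From mathcomp Require Import lra.

(** A function [F : X -> [0, 1]] such that [F (act g x)] is 1-Lipschitz in [g]
    yields an equivariant map [x |-> (g |-> F (act g x))] into [Lip1 d], and
    every such map arises in this way. The problem is to find one Borel [F]
    whose values along an orbit determine the base point.

    A countable family of such functions is obtained by category. For a Borel
    set [C], let [hitting_distance C x] be the distance (truncated at 1) from
    the identity to the set of group elements near which [act h x] belongs to
    [C] for nonmeagerly many [h]. It is Borel because category quantifiers
    preserve measurability ([vaught_product]), it is 1-Lipschitz along orbits
    because the metric is right-invariant, and when [C] runs through a
    separating family these distances separate points, by the Baire category
    theorem ([hitting_distances_injective]). This gives countably many Borel
    coordinates, continuous along every orbit ([orbit_coordinates_exist]).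

    One function replaces this family by means of a lacunary section: a set
    [section_points] meeting every orbit, in which two points of an orbit
    within a small distance [2 * eps] along the group coincide. Let [code] be
    an injective real function, lower semicontinuous along orbits. In a set
    [window l] which is closed along orbits, consider the points whose code is
    minimal among the nearby points of the window on their orbit. They are
    lacunary since [code] is injective ([lacunary_points_eq]). By compactness
    of small balls of [G], a sufficiently small window around [x] meets a
    compact piece of the orbit of [x] only close to [x] ([isolating_window]),
    and then the minimum of the code near [x] is lacunary. There are countably
    many windows; each orbit uses the first one that works for it.

    Finally [F = peaks section_points] is the upper envelope, along each orbit,
    of cones of slope one over the points [y] of the section, of height [eps /
    2 * (1 + code y)]. From the envelope one reads off a point of the section
    and its position on the orbit, hence the base point ([peaks_injective]).
    The function is Borel because at most one summit is visible from a given
    point, and it is the solution of a minimization over a compact ball of [G];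
    such minimizations are measurable by [sigma_compact_projection]. Borel
    measurability into [Lip1 d] reduces to evaluations at a countable dense
    set, which generate the compact-open topology on Lipschitz functions
    ([compact_open_Lip1_box]). *)

Set Implicit Arguments.
Unset Strict Implicit.
Unset Printing Implicit Defensive.

Import Order.TTheory GRing.Theory Num.Theory.
Import numFieldNormedType.Exports.

Local Open Scope classical_set_scope.
Local Open Scope ring_scope.

(** * Sigma-algebras as set systems *)

Section SigmaAlgebra.
Context {X : Type} {S : set (set X)} (hS : sigma_algebra setT S).

Lemma sigma_setC A : S A -> S (~` A).
Proof. by case: hS => _ h _ /h; rewrite setTD. Qed.

Lemma sigma_bigcup (I : countType) (A : I -> set X) :
  (forall i, S (A i)) -> S (\bigcup_i A i).
Proof.
case: hS => h0 _ hU hA.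
have -> : \bigcup_i A i =
    \bigcup_n (if unpickle n is Some i then A i else set0).
  apply/seteqP; split=> [x [i _ Aix]|x [n _]].
    by exists (pickle i) => //; rewrite pickleK.
  by case: unpickle => // i Aix; exists i.
by apply: hU => n; case: unpickle.
Qed.

Lemma sigma_bigcap (I : countType) (A : I -> set X) :
  (forall i, S (A i)) -> S (\bigcap_i A i).
Proof.
move=> hA; rewrite -[X in S X]setCK setC_bigcap; apply: sigma_setC.
by apply: sigma_bigcup => i; apply: sigma_setC.
Qed.

Lemma sigma_const (P : Prop) : S [set _ | P].
Proof.
have h0 : S set0 by case: hS.
have [p|np] := pselect P.
  suff -> : [set _ : X | P] = ~` set0 by exact: sigma_setC.
  by apply/seteqP; split=> x //= _ [].
suff -> : [set _ : X | P] = set0 by [].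
by apply/seteqP; split=> x //=.
Qed.

Lemma sigma_setI A C : S A -> S C -> S (A `&` C).
Proof.
move=> hA hC; rewrite (_ : A `&` C = \bigcap_(b : bool) (if b then A else C)).
  by apply: sigma_bigcap; case.
apply/seteqP; split=> [x [Ax Cx] [] //|x h].
by split; [exact: (h true)|exact: (h false)].
Qed.

Lemma sigma_setU A C : S A -> S C -> S (A `|` C).
Proof.
by move=> hA hC; rewrite -[X in S X]setCK setCU; apply: sigma_setC;
  apply: sigma_setI; apply: sigma_setC.
Qed.

Lemma sigma_ex (I : countType) (P : I -> X -> Prop) :
  (forall i, S [set x | P i x]) -> S [set x | exists i, P i x].
Proof.
move=> h; rewrite (_ : mkset _ = \bigcup_i [set x | P i x]).
  exact: sigma_bigcup.
by apply/seteqP; split=> [x [i ?]|x [i _ ?]]; exists i.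
Qed.

Lemma sigma_all (I : countType) (P : I -> X -> Prop) :
  (forall i, S [set x | P i x]) -> S [set x | forall i, P i x].
Proof.
move=> h; rewrite (_ : mkset _ = \bigcap_i [set x | P i x]).
  exact: sigma_bigcap.
by apply/seteqP; split=> [x hx i _|x hx i]; exact: hx.
Qed.

End SigmaAlgebra.

Lemma sub_generated_sigma {T : Type} {A S : set (set T)} :
  sigma_algebra setT S -> A `<=` S -> <<s A >> `<=` S.
Proof. by move=> hS AS C; apply; split. Qed.

(** * Meager sets and the Baire property *)

Section Meager.
Context {T : topologicalType}.
Implicit Types A U V : set T.

Definition meager A := exists O : nat -> set T,
  (forall n, open (O n) /\ dense (O n)) /\ A `<=` \bigcup_n ~` O n.

Lemma meagerS A C : A `<=` C -> meager C -> meager A.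
Proof. by move=> sAC [W [hO CO]]; exists W; split=> // x /sAC /CO. Qed.

Lemma meager0 : meager set0.
Proof.
exists (fun=> setT); split=> // n; split; first exact: openT.
by move=> U [x Ux] _; exists x.
Qed.

Lemma meager_bigcup (I : countType) (A : I -> set T) :
  (forall i, meager (A i)) -> meager (\bigcup_i A i).
Proof.
move=> /choice[W hW].
exists (fun n => if unpickle n is Some p then W p.1 p.2 else setT).
split=> [n|x [i _ Aix]].
  case: unpickle => [[i k]|]; first exact: (hW i).1.
  split; first exact: openT.
  by move=> U [x Ux] _; exists x.
have [k _ Ok] := (hW i).2 _ Aix.
by exists (pickle (i, k)) => //; rewrite pickleK.
Qed.

Lemma meagerU A C : meager A -> meager C -> meager (A `|` C).
Proof.
move=> hA hC; apply: (@meagerS _ (\bigcup_(b : bool) (if b then A else C))).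
  by move=> x [Ax|Cx]; [exists true|exists false].
by apply: meager_bigcup; case.
Qed.

Lemma meager_nowhere_dense U : open U -> dense U -> meager (~` U).
Proof. by move=> oU dU; exists (fun=> U); split=> // x Ux; exists 0%N. Qed.

(** For second countable spaces this is equivalent to being equal to an open
    set up to a meager set; the present form is symmetric under complement and
    is what the arguments by density of open sets use. *)
Definition baire_property A := forall U, open U -> U !=set0 ->
  exists V, [/\ open V, V !=set0, V `<=` U &
    meager (A `&` V) \/ meager (V `\` A)].

Lemma baire_property_open U : open U -> baire_property U.
Proof.
move=> oU V oV V0; have [VU|VU] := pselect (V `&` U !=set0).
  exists (V `&` U); split=> //; first exact: openI.
  by right; apply: meagerS meager0 => x [[_ Ux]].
exists V; split=> //; left; apply: meagerS meager0 => x [Ux Vx].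
by apply: VU; exists x.
Qed.

Lemma baire_propertyC A : baire_property A -> baire_property (~` A).
Proof.
move=> hA U oU U0; have [V [oV V0 VU hV]] := hA U oU U0.
exists V; split=> //; case: hV => h; [right|left].
  by rewrite setDE setCK setIC.
by rewrite setIC -setDE.
Qed.

Context (Tsc : @second_countable T).

Lemma countable_basis : exists b : nat -> set T,
  (forall n, open (b n)) /\
  (forall x U, open U -> U x -> exists n, b n x /\ b n `<=` U).
Proof.
have [B cB [oB nB]] := Tsc.
have [B0|B0] := pselect (B !=set0); last first.
  exists (fun=> set0); split=> [n|x U oU Ux]; first exact: open0.
  have [V [BV _] _] := nB x U (open_nbhs_nbhs (conj oU Ux)).
  by exfalso; apply: B0; exists V.
have /pfcard_geP[B00|[f]] := cB; first by rewrite B00 in B0; case: B0.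
exists f; split=> [n|x U oU Ux]; first by apply: oB; apply: funS.
have [V [BV Vx] VU] := nB x U (open_nbhs_nbhs (conj oU Ux)).
by have [n _ fn] := @surj _ _ _ _ f _ BV; exists n; rewrite fn.
Qed.

(** Banach category theorem. The basic open sets on which [A] is meager have a
    dense open union: the part of [A] inside is a countable union of meager
    sets, and the part outside is nowhere dense. *)
Lemma meager_locally A :
  (forall U, open U -> U !=set0 ->
     exists V, [/\ open V, V !=set0, V `<=` U & meager (A `&` V)]) ->
  meager A.
Proof.
move=> hA; have [b [ob hb]] := countable_basis.
pose O := \bigcup_(n in [set n | meager (A `&` b n)]) b n.
have oO : open O by apply: bigcup_open.
have dO : dense O.
  move=> U U0 oU; have [V [oV [x Vx] VU mV]] := hA U oU U0.
  have [n [bx bV]] := hb x V oV Vx.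
  exists x; split; first exact: VU.
  by exists n => //=; apply: meagerS mV; exact: setIS.
apply: (@meagerS _ (~` O `|` \bigcup_n (A `&` (O `&` b n) `&`
    [set _ | meager (A `&` b n)]))).
  move=> x Ax; have [Ox|Ox] := pselect (O x); last by left.
  by right; case: (Ox) => n /= mn bn; exists n.
apply: meagerU; first exact: meager_nowhere_dense.
apply: meager_bigcup => n; have [m|m] := pselect (meager (A `&` b n)).
  by apply: meagerS m => x [[? [_ ?]] _].
by apply: meagerS meager0 => x [_] /=.
Qed.

(** A nonmeager set with the Baire property cannot be negligible on densely
    many open sets, so it is conegligible on one of them. *)
Lemma nonmeager_baire A U : open U -> baire_property A ->
  ~ meager (A `&` U) ->
  exists V, [/\ open V, V !=set0, V `<=` U & meager (V `\` A)].
Proof.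
move=> oU bA nm; apply: contrapT => hno; apply: nm; apply: meager_locally.
move=> V oV V0; have [VU|VU] := pselect (V `&` U !=set0); last first.
  exists V; split=> //; apply: meagerS meager0 => x [[_ Ux] Vx].
  by apply: VU; exists x.
have [W [oW W0 WVU [m|m]]] := bA (V `&` U) (openI oV oU) VU.
  exists W; split=> //; first by move=> x /WVU[].
  by apply: meagerS m => x [[]].
by exfalso; apply: hno; exists W; split=> // x /WVU[].
Qed.

(** For a countable union: if some member is conegligible somewhere in [U], so
    is the union; otherwise every member is meager in [U] by [nonmeager_baire].
    *)
Lemma sigma_algebra_baire_property : sigma_algebra setT baire_property.
Proof.
split; first exact: baire_property_open open0.
  by move=> A hA; rewrite setTD; exact: baire_propertyC.
move=> A hA U oU U0.
have [[n [V [oV V0 VU mV]]]|hno] := pselect (exists n V,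
    [/\ open V, V !=set0, V `<=` U & meager (V `\` A n)]).
  exists V; split=> //; right; apply: meagerS mV.
  by move=> x [Vx h]; split=> // Ax; apply: h; exists n.
exists U; split=> //; left; rewrite setI_bigcupl; apply: meager_bigcup => n.
apply: contrapT => /(nonmeager_baire oU (hA n))[V hV].
by apply: hno; exists n, V.
Qed.

Lemma baire_property_borel A : borel A -> baire_property A.
Proof.
apply: (sub_generated_sigma sigma_algebra_baire_property).
exact: baire_property_open.
Qed.

End Meager.

(** * Vaught transforms *)

Section Vaught.
Context {T : topologicalType} (Tsc : @second_countable T).
Context (Tbaire : forall U : set T, open U -> U !=set0 -> ~ meager U).
Context {X : Type} {S : set (set X)} (hS : sigma_algebra setT S).

(** The Baire property of the sections is carried along because it is what
    makes the category condition pass to complements. *)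
Definition vaught_measurable (E : set (T * X)) :=
  [/\ forall x, baire_property [set g | E (g, x)],
      forall g, S [set x | E (g, x)] &
      forall U, open U -> S [set x | ~ meager ([set g | E (g, x)] `&` U)]].

Lemma sigma_algebra_vaught : sigma_algebra setT vaught_measurable.
Proof.
have [b [ob hb]] := countable_basis Tsc.
have hQ := @sigma_algebra_baire_property T Tsc.
split.
- split=> [x|g|U oU].
  + exact: baire_property_open open0.
  + exact: (sigma_const hS False).
  + rewrite (_ : mkset _ = [set _ | ~ meager (set0 `&` U)]) //.
    exact: (sigma_const hS).
- move=> E [E1 E2 E3]; rewrite setTD; split=> [x|g|U oU].
  + exact: (baire_propertyC (E1 x)).
  + exact: (sigma_setC hS (E2 g)).
  + pose P n x := [/\ b n `<=` U, b n !=set0 &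
                     meager ([set g | E (g, x)] `&` b n)].
    (* A complement is nonmeager in U iff the set itself is meager in some
       nonempty basic open subset of U. *)
    rewrite (_ : mkset _ = [set x | exists n, P n x]).
      apply: (sigma_ex hS) => n.
      have [bU|bU] := pselect (b n `<=` U /\ b n !=set0).
        rewrite (_ : mkset _ =
            ~` [set x | ~ meager ([set g | E (g, x)] `&` b n)]).
          exact: sigma_setC (E3 _ (ob n)).
        apply/seteqP; split=> x /=; first by case=> _ _ m; exact.
        by case: bU => bU b0 /contrapT m; split.
      rewrite (_ : mkset _ = [set _ | False]); first exact: (sigma_const hS).
      by apply/seteqP; split=> x //= [? ? _]; apply: bU.
    apply/seteqP; split=> x /=.
      move=> nm; have [V [oV [y Vy] VU mV]] :=
        nonmeager_baire Tsc oU (baire_propertyC (E1 x)) nm.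
      have [n [bn bV]] := hb _ _ oV Vy.
      exists n; split; [exact: subset_trans VU|by exists y|].
      apply: meagerS mV => z [Ez bz]; split; first exact: bV.
      by apply.
    move=> [n [bU b0 m]] m'; apply: (Tbaire (ob n) b0).
    apply: meagerS (meagerU m m') => y by_.
    by have [Ey|Ey] := pselect (E (y, x)); [left|right; split=> //; exact: bU].
- move=> E hE; split=> [x|g|U oU].
  + rewrite (_ : mkset _ = \bigcup_n [set g | E n (g, x)]).
      by case: hQ => _ _; apply=> n; case: (hE n).
    by apply/seteqP; split=> g /= [n _ ?]; exists n.
  + rewrite (_ : mkset _ = [set x | exists n, E n (g, x)]).
      by apply: (sigma_ex hS) => n; case: (hE n).
    by apply/seteqP; split=> x /= [n] => [_|] ?; exists n.
  + rewrite (_ : mkset _ =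
      [set x | exists n, ~ meager ([set g | E n (g, x)] `&` U)]).
      by apply: (sigma_ex hS) => n; case: (hE n) => _ _; apply.
    apply/seteqP; split=> x /= => [nm|[n nm] m].
      apply: contrapT => /forallNP h; apply: nm.
      apply: (@meagerS _ _ (\bigcup_n ([set g | E n (g, x)] `&` U))).
        by move=> g [[n _ Eg] Ug]; exists n.
      by apply: meager_bigcup => n; exact: contrapT (h n).
    by apply: nm; apply: meagerS m => g [Eg Ug]; split=> //; exists n.
Qed.

(** The Borel case of the Kuratowski-Ulam theory: category quantifiers over the
    first factor preserve measurability in the second one. *)
Lemma vaught_product E : product_sigma (@borel T) S E -> vaught_measurable E.
Proof.
apply: (sub_generated_sigma sigma_algebra_vaught) => _ [C bC [D hD] <-].
have slice x : [set g | (C `*` D) (g, x)] = if x \in D then C else set0.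
  apply/seteqP; split=> g /=.
    by case=> Cg Dx; rewrite mem_set.
  by case: ifPn => // /set_mem.
split=> [x|g|U oU].
- rewrite slice; case: ifP => _; last exact: baire_property_open open0.
  exact: baire_property_borel.
- rewrite (_ : mkset _ = [set _ | C g] `&` D) //.
  by apply: (sigma_setI hS) => //; exact: (sigma_const hS).
- rewrite (_ : mkset _ = D `&` [set _ | ~ meager (C `&` U)]).
    by apply: (sigma_setI hS) => //; exact: (sigma_const hS).
  apply/seteqP; split=> x /=; rewrite slice.
    case: ifPn => [/set_mem //|_] []; apply: meagerS meager0.
    by move=> g [].
  by move=> [Dx m]; rewrite mem_set.
Qed.

End Vaught.

(** * Locally compact metric spaces *)

Lemma compact_seq_cluster {T : topologicalType} (K : set T) (u : nat -> T) :
  compact K -> (forall n, K (u n)) ->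
  exists2 x, K x & forall U, open U -> U x ->
    forall N, exists2 n, (N <= n)%N & U (u n).
Proof.
move=> cK Ku; have [x [Kx cx]] : K `&` cluster (u @ \oo) !=set0.
  by apply: cK; exists 0%N => // n _; exact: Ku.
exists x => // U oU Ux N.
have [||_ [[n Nn <-] Un]] := cx [set u n | n in [set n | (N <= n)%N]] U.
- by exists N => // n Nn; exists n.
- by rewrite nbhsE; exists U.
by exists n.
Qed.

(** The compactness principle used both to find minima and to prove that they
    depend measurably on parameters: approximate solutions in a compact set of
    countably many closed conditions accumulate at an exact one. *)
Lemma compact_approx {R : realType} {T : topologicalType} {I : countType}
    (K : set T) (P : I -> T -> R) :
  compact K -> (forall i, continuous (P i)) ->
  (forall n, exists v, K v /\
     forall i, (pickle i <= n)%N -> P i v <= n.+1%:R^-1) ->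
  exists2 v, K v & forall i, P i v <= 0.
Proof.
move=> cK cP /choice[u hu].
have [v Kv hv] := compact_seq_cluster cK (fun n => (hu n).1).
exists v => // i; rewrite leNgt; apply/negP => Pv.
have [|N hN] := @ltr_add_invr _ 0 (P i v / 2) _; first by rewrite divr_gt0.
rewrite add0r in hN.
have oU : open (P i @^-1` [set r | P i v / 2 < r]).
  by apply: open_comp => [x _|]; [exact: cP|exact: open_gt].
have [|n Nn /= Un] := hv _ oU _ (maxn N (pickle i)).
  by rewrite /= ltr_pdivrMr // mulr2n mulrDr mulr1 ltrDl.
move: Nn; rewrite geq_max => /andP[Nn in_]; have := (hu n).2 i in_.
rewrite leNgt => /negP; apply; apply: le_lt_trans Un; apply: ltW.
by apply: le_lt_trans hN; rewrite lef_pV2 ?posrE ?ltr0n// ler_nat.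
Qed.

Section Metric.
Context {R : realType} {T : topologicalType} (d : T -> T -> R).
Context (dc : compatible_metric d).

Let mT : is_metric d. Proof. by case: dc. Qed.

Lemma metric_xx x : d x x = 0. Proof. exact/(metric_eq0 mT). Qed.

Lemma metric_ge0 x y : 0 <= d x y.
Proof.
have := metric_triangular mT x y x; rewrite metric_xx (metric_symmetric mT y x).
by rewrite -mulr2n pmulrn_lge0.
Qed.

Lemma metric_ltD x y z a b : d x y < a -> d y z < b -> d x z < a + b.
Proof.
by move=> h1 h2; apply: le_lt_trans (metric_triangular mT x y z) (ltrD h1 h2).
Qed.

Lemma open_metric A x : open A -> A x ->
  exists2 e : R, 0 < e & [set y | d x y < e] `<=` A.
Proof. by move=> /dc.2 h /h. Qed.

Lemma open_mball x r : open [set y | d x y < r].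
Proof.
apply/dc.2 => y /= xy; exists (r - d x y); first by rewrite subr_gt0.
move=> z /= yz; apply: le_lt_trans (metric_triangular mT x y z) _.
by rewrite -ltrBrDl.
Qed.

Lemma closed_mball x r : closed [set y | d x y <= r].
Proof.
rewrite (_ : mkset _ = ~` [set y | r < d x y]).
  apply: open_closedC; apply/dc.2 => y /= xy.
  exists (d x y - r); first by rewrite subr_gt0.
  move=> z /= yz; rewrite ltrBrDr in yz.
  have := metric_triangular mT x z y; rewrite (metric_symmetric mT z y).
  by move=> h; rewrite -(ltrD2l (d y z)) (lt_le_trans yz)// addrC.
by apply/seteqP; split=> y /=; rewrite leNgt => /negP.
Qed.

Lemma lipschitz_continuous (f : T -> R) :
  (forall x y, `|f x - f y| <= d x y) -> continuous f.
Proof.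
move=> hf x; apply/cvgrPdist_lt => e e0.
have : nbhs x [set y | d x y < e].
  by apply: open_nbhs_nbhs; split; [exact: open_mball|rewrite /= metric_xx].
by apply: filterS => y /=; exact: le_lt_trans.
Qed.

Context (Tlc : locally_compact [set: T]).

Lemma compact_mball x : exists2 r, 0 < r & compact [set y | d x y <= r].
Proof.
have [U nU [cU clU]] := Tlc (I : [set: T] x).
move: nU; rewrite withinET nbhsE => -[V [oV Vx] VU].
have [e e0 eV] := open_metric oV Vx.
exists (e / 2); first by rewrite divr_gt0.
apply: (subclosed_compact (@closed_mball x (e / 2)) cU) => y /= xy.
suff : V y by move=> /VU; apply.
apply: eV => /=; apply: le_lt_trans xy _.
by rewrite ltr_pdivrMr // ltr_pMr// ltr1n.
Qed.

(** Nested open sets [V n] whose closures avoid the successive nowhere dense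
    pieces, starting inside a compact ball, have a common point. *)
Lemma baire_locally_compact (U : set T) : open U -> U !=set0 -> ~ meager U.
Proof.
move=> oU [x Ux] [W [oW UW]].
have shrink (V : set T) y : open V -> V y ->
    exists V', [/\ open V', V' y & closure V' `<=` V].
  move=> oV Vy; have [e e0 eV] := open_metric oV Vy.
  exists [set z | d y z < e / 2]; split; first exact: open_mball.
    by rewrite /= metric_xx divr_gt0.
  have sub : [set z | d y z < e / 2] `<=` [set z | d y z <= e / 2].
    by move=> w /ltW.
  have /closure_id cE := @closed_mball y (e / 2).
  move=> z /(closureS sub); rewrite -cE => yz; apply: eV.
  apply: le_lt_trans yz _.
  by rewrite ltr_pdivrMr // ltr_pMr// ltr1n.
have step (p : nat * set T) : exists V', open p.2 -> p.2 !=set0 ->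
    [/\ open V', V' !=set0 & closure V' `<=` p.2 `&` W p.1].
  have [[oV V0]|h] := pselect (open p.2 /\ p.2 !=set0); last first.
    by exists set0 => ? ?; exfalso; apply: h.
  have [oWn dWn] := oW p.1.
  have [y Vy] := dWn _ V0 oV.
  have [V' [oV' V'y cV']] := shrink _ y (openI oV oWn) Vy.
  by exists V'; split=> //; exists y.
have [f hf] := choice step.
have [r r0 cK] := compact_mball x.
pose V0 := U `&` [set y | d x y < r].
pose V := fix V n := if n is m.+1 then f (m, V m) else V0.
have hV n : open (V n) /\ V n !=set0.
  elim: n => [|n [oV V0n]] /=; last by have [] := hf (n, V n) oV V0n.
  split; first by apply: openI => //; exact: open_mball.
  by exists x; split=> //=; rewrite metric_xx.
have hS n : closure (V n.+1) `<=` V n `&` W n.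
  by have [oV V0n] := hV n; have [] := hf (n, V n) oV V0n.
have VS m n : (m <= n)%N -> V n `<=` V m.
  move=> /subnK <-; elim: (n - m)%N => //= k IH y Vy; apply: IH.
  by have [] := hS _ _ (subset_closure Vy).
have [u hu] := choice (fun n => (hV n).2).
have Ku n : [set y | d x y <= r] (u n).
  by have /(_ _)[|_ /ltW] := VS 0%N n isT (u n).
have [y Ky hy] := compact_seq_cluster cK Ku.
have Vy n : (V n `&` W n) y.
  apply: hS => A; rewrite nbhsE => -[A' [oA' A'y] A'A].
  have [k nk Ak] := hy _ oA' A'y n.+1.
  by exists (u k); split; [exact: VS (hu k)|exact: A'A].
have [n _ nW] := UW y (Vy 0%N).1.1.
exact: nW (Vy n).2.
Qed.

End Metric.

(** * Measurable real functions on a set system *)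

Section MeasurableReal.
Context {R : realType} {X : Type} {S : set (set X)} (hS : sigma_algebra setT S).
Implicit Types f g : X -> R.

Definition measurable_real f := forall c, S [set x | f x < c].

Lemma rat_between (a b : R) : a < b -> exists2 q : rat, a < ratr q & ratr q < b.
Proof. by move=> /rat_in_itvoo[q]; rewrite in_itv /= => /andP[]; exists q. Qed.

Lemma measurable_real_ge f c : measurable_real f -> S [set x | c <= f x].
Proof.
move=> mf; rewrite (_ : mkset _ = ~` [set x | f x < c]).
  exact: sigma_setC (mf c).
by apply/seteqP; split=> x /=; rewrite leNgt => /negP.
Qed.

Lemma measurable_real_gt f c : measurable_real f -> S [set x | c < f x].
Proof.
move=> mf; rewrite (_ : mkset _ =
    [set x | exists q : rat, c < ratr q /\ ratr q <= f x]).
  apply: (sigma_ex hS) => q; apply: (sigma_setI hS).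
    exact: (sigma_const hS).
  exact: measurable_real_ge.
apply/seteqP; split=> x /= => [/rat_between[q cq qf]|[q [cq]]].
  by exists q; split=> //; exact: ltW.
exact: lt_le_trans.
Qed.

Lemma measurable_real_le f c : measurable_real f -> S [set x | f x <= c].
Proof.
move=> mf; rewrite (_ : mkset _ = ~` [set x | c < f x]).
  exact: sigma_setC (measurable_real_gt c mf).
by apply/seteqP; split=> x /=; rewrite leNgt => /negP.
Qed.

Lemma measurable_real_lt2 f g : measurable_real f -> measurable_real g ->
  S [set x | f x < g x].
Proof.
move=> mf mg; rewrite (_ : mkset _ =
    [set x | exists q : rat, f x < ratr q /\ ratr q < g x]).
  apply: (sigma_ex hS) => q; apply: (sigma_setI hS); first exact: mf.
  exact: measurable_real_gt.
apply/seteqP; split=> x /= => [/rat_between[q fq qg]|[q [fq]]].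
  by exists q.
exact: lt_trans.
Qed.

Lemma measurable_realN f :
  measurable_real f -> measurable_real (fun x => - f x).
Proof.
move=> mf c; rewrite (_ : mkset _ = [set x | - c < f x]).
  exact: measurable_real_gt.
by apply/seteqP; split=> x /=; rewrite ltrNl.
Qed.

(** A down-closed set of reals, unless it has a greatest element, is a union of
    countably many rays with rational endpoints. *)
Lemma measurable_real_down (D : set R) f : measurable_real f ->
  (forall a b, a <= b -> D b -> D a) -> S [set x | D (f x)].
Proof.
move=> mf hD; have [[M [DM hM]]|noM] :=
    pselect (exists M, D M /\ forall a, D a -> a <= M).
  rewrite (_ : mkset _ = [set x | f x <= M]); first exact: measurable_real_le.
  by apply/seteqP; split=> x /=; [exact: hM|move=> /hD; exact].
rewrite (_ : mkset _ = [set x | exists q : rat, f x < ratr q /\ D (ratr q)]).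
  apply: (sigma_ex hS) => q; apply: (sigma_setI hS); first exact: mf.
  exact: (sigma_const hS).
apply/seteqP; split=> x /= => [Dfx|[q [/ltW h]]]; last exact: hD.
have [b Db fb] : exists2 b, D b & f x < b.
  apply: contrapT => h; apply: noM; exists (f x); split=> // a Da.
  by rewrite leNgt; apply/negP => fa; apply: h; exists a.
have [q fq qb] := rat_between fb.
by exists q; split=> //; exact: hD (ltW qb) Db.
Qed.

Lemma measurable_real_mono (phi : R -> R) f :
  {homo phi : a b / a <= b} -> measurable_real f -> measurable_real (phi \o f).
Proof.
move=> hphi mf c.
apply: (measurable_real_down (D := [set a | phi a < c])) => //.
by move=> a b /hphi; exact: le_lt_trans.
Qed.

Lemma measurable_realD f g : measurable_real f -> measurable_real g ->
  measurable_real (fun x => f x + g x).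
Proof.
move=> mf mg c; rewrite (_ : mkset _ = [set x | f x < c - g x]); last first.
  by apply/seteqP; split=> x /=; rewrite ltrBrDr.
apply: measurable_real_lt2 => //.
apply: (@measurable_real_mono (fun a => c + a)) (measurable_realN mg).
by move=> a b; rewrite lerD2l.
Qed.

Lemma measurable_real_cst (c : R) : measurable_real (fun=> c).
Proof. by move=> a; exact: (sigma_const hS). Qed.

Lemma measurable_real_sum (I : Type) (s : seq I) (f : I -> X -> R) :
  (forall i, measurable_real (f i)) ->
  measurable_real (fun x => \sum_(i <- s) f i x).
Proof.
move=> mf; elim: s => [|i s IH].
  rewrite (_ : (fun _ => _) = fun=> 0); first exact: measurable_real_cst.
  by apply/funext => x; rewrite big_nil.
rewrite (_ : (fun _ => _) = fun x => f i x + \sum_(j <- s) f j x).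
  exact: measurable_realD.
by apply/funext => x; rewrite big_cons.
Qed.

Lemma measurable_real_of_gt f :
  (forall c, S [set x | c < f x]) -> measurable_real f.
Proof.
move=> hf c; rewrite (_ : mkset _ =
    [set x | exists q : rat, ~ ratr q < f x /\ ratr q < c]).
  apply: (sigma_ex hS) => q.
  apply: (sigma_setI hS); last exact: (sigma_const hS).
  exact: (sigma_setC hS (hf _)).
apply/seteqP; split=> x /= => [/rat_between[q q1 q2]|[q [/negP]]].
  by exists q; split=> //; apply/negP; rewrite -leNgt ltW.
by rewrite -leNgt; exact: le_lt_trans.
Qed.

End MeasurableReal.

Lemma continuous_sum_seq {R : realType} {T : topologicalType} {I : Type}
    (s : seq I) (f : I -> T -> R) :
  (forall i, continuous (f i)) -> continuous (fun x => \sum_(i <- s) f i x).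
Proof.
move=> cf; elim: s => [|i s IH] x.
  rewrite (_ : (fun _ => _) = fun=> 0); first exact: cst_continuous.
  by apply/funext => y; rewrite big_nil.
rewrite (_ : (fun _ => _) = f i \+ (fun y => \sum_(j <- s) f j y)).
  by apply: continuousD; [exact: cf|exact: IH].
by apply/funext => y; rewrite big_cons.
Qed.

(** * Projections along compact sets *)

Definition dense_family {T : topologicalType} {J : Type} (K : set T)
    (D : J -> T) :=
  (forall j, K (D j)) /\
  forall U, open U -> (K `&` U) !=set0 -> exists j, U (D j).

Lemma dense_family_exists {T : topologicalType} (K : set T) :
  @second_countable T -> K !=set0 -> exists D : nat -> T, dense_family K D.
Proof.
move=> Tsc [k Kk]; have [b [_ hb]] := countable_basis Tsc.
have /choice[D hD] : forall n, exists x, K x /\ ((K `&` b n) !=set0 -> b n x).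
  move=> n; have [[x [Kx bx]]|h] := pselect ((K `&` b n) !=set0).
    by exists x.
  by exists k.
exists D; split=> [n|U oU [x [Kx Ux]]]; first exact: (hD n).1.
have [n [bx bU]] := hb _ _ oU Ux.
by exists n; apply: bU; apply: (hD n).2; exists x.
Qed.

Lemma dense_familyX {T1 T2 : topologicalType} {J1 J2 : Type}
    (K1 : set T1) (K2 : set T2) (D1 : J1 -> T1) (D2 : J2 -> T2) :
  dense_family K1 D1 -> dense_family K2 D2 ->
  dense_family (K1 `*` K2) (fun j : J1 * J2 => (D1 j.1, D2 j.2)).
Proof.
move=> [h1 d1] [h2 d2]; split=> [j|U oU [[x y] [[/= K1x K2y] Uxy]]].
  by split; [exact: h1|exact: h2].
have : nbhs (x, y) U by exact: open_nbhs_nbhs.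
move=> [[A B] /= [nA nB] AB].
move: nA nB; rewrite !nbhsE => -[A' [oA' A'x] A'A] [B' [oB' B'y] B'B].
have [i Ai] := d1 _ oA' (ex_intro _ x (conj K1x A'x)).
have [j Bj] := d2 _ oB' (ex_intro _ y (conj K2y B'y)).
by exists (i, j); apply: AB; split; [exact: A'A|exact: B'B].
Qed.

Section Projection.
Context {R : realType} {X : Type} {S : set (set X)} (hS : sigma_algebra setT S).
Context {T : topologicalType} {I J : countType}.

Lemma open_finitely_many (P : I -> T -> R) (v : T) (e : R) (n : nat) :
  (forall i, continuous (P i)) -> (forall i, P i v < e) ->
  exists U, [/\ open U, U v &
    forall w, U w -> forall i, (pickle i < n)%N -> P i w < e].
Proof.
move=> cP hv; elim: n => [|n [U [oU Uv hU]]].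
  by exists setT; split=> //; exact: openT.
case E : (@unpickle I n) => [i|]; last first.
  exists U; split=> // w Uw i; rewrite ltnS leq_eqVlt => /orP[/eqP ni|].
    by rewrite -ni pickleK in E.
  exact: hU.
exists (U `&` P i @^-1` [set r | r < e]); split.
- apply: openI => //; apply: open_comp => [x _|]; first exact: cP.
  exact: open_lt.
- by split=> //; exact: hv.
move=> w [Uw Pw] j; rewrite ltnS leq_eqVlt => /orP[/eqP ni|].
  by move: E; rewrite -ni pickleK => -[->].
exact: hU.
Qed.

(** A measurable relation which is closed in a compact variable has a
    measurable projection: the existential quantifier can be replaced with a
    countable one over approximate solutions. *)
Lemma sigma_compact_projection (K : set T) (D : J -> T) (P : I -> T -> X -> R) :
  compact K -> dense_family K D ->
  (forall i z, continuous (fun v => P i v z)) ->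
  (forall i v, @measurable_real R X S (P i v)) ->
  S [set z | exists2 v, K v & forall i, P i v z <= 0].
Proof.
move=> cK [KD dD] cP mP.
rewrite (_ : mkset _ = [set z | forall n : nat, exists j : J, forall i,
    (pickle i <= n)%N -> P i (D j) z <= n.+1%:R^-1]).
  apply: (sigma_all hS) => n; apply: (sigma_ex hS) => j.
  apply: (sigma_all hS) => i; case: leqP => _.
    rewrite (_ : mkset _ = [set z | P i (D j) z <= n.+1%:R^-1]).
      exact: measurable_real_le.
    by apply/seteqP; split=> z //=; exact.
  rewrite (_ : mkset _ = [set _ | True]); first exact: (sigma_const hS).
  by apply/seteqP; split.
apply/seteqP; split=> z /= => [[v Kv Pv] n|h].
  have [|U [oU Uv hU]] := @open_finitely_many (fun i w => P i w z) v n.+1%:R^-1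
      n.+1 (cP^~ z).
    by move=> i; rewrite (le_lt_trans (Pv i))// invr_gt0 ltr0n.
  have [j Uj] := dD U oU (ex_intro _ v (conj Kv Uv)).
  by exists j => i ni; apply: ltW; apply: hU.
apply: (@compact_approx R T I K (fun i v => P i v z) cK (cP^~ z)) => n.
by have [j hj] := h n; exists (D j).
Qed.

End Projection.

(** * Right-invariant metrics *)

Section GroupMetric.
Context {R : realType} {G : topologicalGroupType} {d : G -> G -> R}.
Context (dc : compatible_metric d) (dr : right_invariant d).

Let mG : is_metric d. Proof. by case: dc. Qed.

Lemma metric_divg g h : d g h = d (g * h^-1)%g 1%g.
Proof. by rewrite -(dr g h h^-1%g) mulgV. Qed.

Lemma length_mulg g h : d (g * h)%g 1%g <= d g 1%g + d h 1%g.
Proof.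
by apply: le_trans (metric_triangular mG _ h _) _; rewrite -{2}(mul1g h) dr.
Qed.

Lemma length_invg g : d g^-1%g 1%g = d g 1%g.
Proof. by rewrite -(dr g^-1%g 1%g g) mulVg mul1g (metric_symmetric mG). Qed.

Lemma continuous_mulgl (g : G) : continuous (fun h : G => (g * h)%g).
Proof.
move=> h; apply: (@continuous2_cvg _ _ _ _ _ _ (fun=> g) id
  (fun a b : G => (a * b)%g)); first exact: (@mulg_continuous G (g, h)).
- exact: cvg_cst.
- exact: cvg_id.
Qed.

Lemma continuous_mulgr (g : G) : continuous (fun h : G => (h * g)%g).
Proof.
move=> h; apply: (@continuous2_cvg _ _ _ _ _ _ id (fun=> g)
  (fun a b : G => (a * b)%g)); first exact: (@mulg_continuous G (h, g)).
- exact: cvg_id.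
- exact: cvg_cst.
Qed.

Lemma meager_translate (A : set G) g :
  meager A -> meager [set h | A (h * g)%g].
Proof.
move=> [W [hW AW]]; exists (fun n => [set h | W n (h * g)%g]).
split=> [n|h /AW[n _ nW]]; last by exists n.
have [oW dW] := hW n; split.
  by apply: (open_comp _ oW) => h _; exact: continuous_mulgr.
move=> U [u Uu] oU.
have [||v [/= Uv Wv]] := dW [set k | U (k * g^-1)%g].
- by exists (u * g)%g; rewrite /= mulgK.
- by apply: (open_comp _ oU) => h _; exact: continuous_mulgr.
by exists (v * g^-1)%g; split=> //=; rewrite mulgVK.
Qed.

End GroupMetric.

(** * Lipschitz coordinates on a Borel system *)

Lemma standard_borel_sigma_algebra {R : realType} {X : Type}
  {B : set (set X)} : standard_borel R B -> sigma_algebra setT B.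
Proof.
move=> [T [phi [_ _ ->]]]; apply: sigma_algebra_preimage.
exact: smallest_sigma_algebra.
Qed.

(** The sets are balls with rational radii around the points of a dense
    sequence: if every such ball containing [x] contains [y], then [x] and [y]
    are at distance zero. *)
Lemma standard_borel_separating {R : realType} {X : Type} {B : set (set X)} :
  standard_borel R B -> exists C : nat -> set X, (forall n, B (C n)) /\
    forall x y, (forall n, C n x -> C n y) -> x = y.
Proof.
move=> [T [phi [[[D cD dD] [e [ec _]]] bphi ->]]].
pose C (p : T * rat) := phi @^-1` [set z | e p.1 z < ratr p.2].
have BC p : preimage_set_system setT phi (@borel T) (C p).
  exists [set z | e p.1 z < ratr p.2]; last by rewrite setTI.
  by apply: sub_gen_smallest; exact: open_mball.
have B0 : preimage_set_system setT phi (@borel T) set0.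
  exists set0; last by rewrite preimage_set0 setI0.
  exact: sigma_algebra0.
have sepC x y : (forall z q, D z -> C (z, q) x -> C (z, q) y) -> x = y.
  move=> h; apply: (bij_inj bphi); apply/(metric_eq0 ec.1).
  apply/eqP; rewrite eq_le (metric_ge0 ec) andbT leNgt; apply/negP => e0.
  have [||z [/= xz Dz]] := dD [set z | e (phi x) z < e (phi x) (phi y) / 2].
  - by exists (phi x); rewrite /= (metric_xx ec) divr_gt0.
  - exact: open_mball.
  have [q xq qh] := rat_between xz.
  have := h z q Dz; rewrite /C /= (metric_symmetric ec.1 z) => /(_ xq) zy.
  have := metric_ltD ec xz (lt_trans zy qh).
  by rewrite -splitr ltxx.
have [D0|D0] := pselect (D !=set0); last first.
  exists (fun=> set0); split=> // x y _; apply: sepC => z q Dz.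
  by exfalso; apply: D0; exists z.
have /pfcard_geP[D00|[f]] := cD; first by rewrite D00 in D0; case: D0.
exists (fun n => if @unpickle (nat * rat)%type n is Some p
  then C (f p.1, p.2) else set0); split=> [n|x y h].
  by case: unpickle.
apply: sepC => z q Dz; have [k _ <-] := @surj _ _ _ _ f _ Dz.
by have := h (pickle (k, q)); rewrite pickleK.
Qed.

Section Coordinates.
Context {R : realType} {G : topologicalGroupType} {d : G -> G -> R}.
Context (dc : compatible_metric d) (dr : right_invariant d).
Context (Gsc : @second_countable G) (Glc : locally_compact [set: G]).
Context {X : Type} {B : set (set X)} {act : G -> X -> X}.
Context (hX : borel_system R B act).

Let mG : is_metric d. Proof. by case: dc. Qed.
Let hB : sigma_algebra setT B.
Proof. exact: standard_borel_sigma_algebra (bs_standard hX). Qed.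
Let Gbaire : forall U : set G, open U -> U !=set0 -> ~ meager U.
Proof. by move=> U; exact: (baire_locally_compact dc Glc). Qed.

Lemma actK g x : act g^-1%g (act g x) = x.
Proof. by rewrite -(bs_actM hX) mulVg (bs_act1 hX). Qed.

Lemma act_inj g : injective (act g).
Proof. by move=> x y /(congr1 (act g^-1%g)); rewrite !actK. Qed.

Lemma act_divg g h x : act (g * h^-1)%g (act h x) = act g x.
Proof. by rewrite -(bs_actM hX) mulgVK. Qed.

Lemma act_vaught C : B C ->
  vaught_measurable (S := B) (fun p : G * X => C (act p.1 p.2)).
Proof. by move=> /(bs_measurable hX); exact: vaught_product. Qed.

Lemma measurable_real_act (f : X -> R) g :
  measurable_real (S := B) f -> measurable_real (S := B) (f \o act g).
Proof. by move=> mf c; have [_ h _] := act_vaught (mf c); exact: h g. Qed.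

Implicit Types C : set X.

Definition hits C x r :=
  ~ meager ([set g | C (act g x)] `&` [set g | d 1%g g < r]).

(** Truncated at 1, this is the distance from the identity to the closed set of
    all [g] near which [C] contains [act h x] for nonmeagerly many [h]. Such a
    distance is 1-Lipschitz along orbits however irregular [C] is, and it moves
    with [x] since the metric is right-invariant. *)
Definition hitting_distance C x :=
  inf [set r | 0 < r /\ (1 <= r \/ hits C x r)].

Lemma hitsW C x r s : r <= s -> hits C x r -> hits C x s.
Proof.
move=> rs h m; apply: h; apply: meagerS m => g [Cg gr]; split=> //=.
exact: lt_le_trans rs.
Qed.

Lemma hits_translate C x g r :
  hits C (act g x) r <->
  ~ meager ([set h | C (act h x)] `&` [set h | d g h < r]).
Proof.
split=> nm m; apply: nm.
  apply: meagerS (meager_translate g m) => h [/= Ch hr].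
  by rewrite (bs_actM hX); split=> //; rewrite -{1}(mul1g g) dr.
apply: meagerS (meager_translate g^-1%g m) => h [/= Ch hr].
by rewrite act_divg; split=> //; rewrite -(dr _ _ g) mul1g mulgVK.
Qed.

Lemma hitting_distance_lt C x c : hitting_distance C x < c <->
  exists r, [/\ 0 < r, 1 <= r \/ hits C x r & r < c].
Proof.
split=> [/inf_lt[|r [r0 hr] rc]|[r [r0 hr rc]]].
- by exists 1; split=> //; left.
- by exists r.
apply: le_lt_trans rc; apply: ge_inf => //.
by exists 0 => s [/ltW].
Qed.

Lemma measurable_hitting_distance C : B C ->
  measurable_real (S := B) (hitting_distance C).
Proof.
move=> BC c; rewrite (_ : mkset _ = [set x | exists q : rat,
    (0 < ratr q :> R /\ (ratr q < c :> R)) /\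
    (1 <= ratr q :> R \/ hits C x (ratr q))]).
  apply: (sigma_ex hB) => q; apply: (sigma_setI hB).
    exact: (sigma_const hB).
  apply: (sigma_setU hB); first exact: (sigma_const hB).
  have [_ _ h] := act_vaught BC; apply: h; exact: open_mball.
apply/seteqP; split=> x /=.
  move/hitting_distance_lt => [r [r0 hr rc]].
  have [q rq qc] := rat_between rc.
  exists q; split; first by split=> //; exact: lt_trans rq.
  case: hr => [r1|hr]; [left|right].
    by rewrite (le_trans r1)// ltW.
  exact: hitsW (ltW rq) hr.
by move=> [q [[q0 qc] hq]]; apply/hitting_distance_lt; exists (ratr q).
Qed.

Lemma hitting_distance_le C x g :
  hitting_distance C x <= hitting_distance C (act g x) + d g 1%g.
Proof.
rewrite leNgt; apply/negP; rewrite -ltrBrDr => /hitting_distance_lt.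
move=> [r [r0 hr]]; rewrite ltrBrDr ltNge => /negP; apply.
have rg : r <= r + d g 1%g by rewrite lerDl metric_ge0.
rewrite leNgt; apply/negP => lt_.
suff : hitting_distance C x < hitting_distance C x by rewrite ltxx.
apply/hitting_distance_lt; exists (r + d g 1%g); split=> //.
  exact: lt_le_trans rg.
case: hr => [r1|/hits_translate hr]; [left|right]; first exact: le_trans rg.
move=> m; apply: hr; apply: meagerS m => h [/= Ch hr]; split=> //=.
apply: le_lt_trans (metric_triangular mG _ g _) _.
by rewrite (metric_symmetric mG 1%g) addrC ltrD2r.
Qed.

Lemma hitting_distance_lipschitz C x g h :
  `|hitting_distance C (act g x) - hitting_distance C (act h x)| <= d g h.
Proof.
rewrite ler_distl; apply/andP; split.
  rewrite lerBlDr.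
  apply: le_trans (hitting_distance_le C (act h x) (g * h^-1)%g) _.
  by rewrite act_divg -(metric_divg dr).
apply: le_trans (hitting_distance_le C (act g x) (h * g^-1)%g) _.
by rewrite act_divg -(metric_divg dr) (metric_symmetric mG).
Qed.

(** If the difference were nonmeager, it would be conegligible in some ball,
    whose center [g] would be close to one of the two closed sets and not to
    the other. *)
Lemma hitting_distance_separates C x y : B C ->
  (forall g, hitting_distance C (act g x) = hitting_distance C (act g y)) ->
  meager ([set g | C (act g x)] `\` [set g | C (act g y)]).
Proof.
move=> BC hxy; apply: contrapT => nm.
have bS z : baire_property [set g | C (act g z)].
  by have [h _ _] := act_vaught BC; exact: h.
have bD : baire_property ([set g | C (act g x)] `\` [set g | C (act g y)]).
  by rewrite setDE; apply: (sigma_setI (sigma_algebra_baire_property Gsc));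
    [exact: bS|exact: baire_propertyC (bS y)].
rewrite -[X in meager X]setIT in nm.
have [V [oV [g Vg] _ mV]] := nonmeager_baire Gsc openT bD nm.
have [e e0 eV] := open_metric dc oV Vg.
pose r := Num.min e 1; have r0 : 0 < r by rewrite lt_min e0 ltr01.
have rV : [set h | d g h < r] `<=` V.
  by move=> h /= hr; apply: eV; rewrite /= (lt_le_trans hr)// ge_min lexx.
have : hitting_distance C (act g x) < r.
  apply/hitting_distance_lt; exists (r / 2); split.
  - by rewrite divr_gt0.
  - right; apply/hits_translate => m.
    apply: (Gbaire (open_mball dc g (r / 2))).
      by exists g; rewrite /= (metric_xx dc) divr_gt0.
    apply: meagerS (meagerU m mV) => h /= hr.
    have hV : V h.
      by apply: rV; rewrite /= (lt_trans hr)// ltr_pdivrMr // ltr_pMr// ltr1n.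
    have [Ch|Ch] := pselect (C (act h x)); first by left.
    by right; split=> // -[].
  - by rewrite ltr_pdivrMr // ltr_pMr// ltr1n.
rewrite hxy => /hitting_distance_lt[s [s0 hs sr]].
case: hs => [s1|/hits_translate hs].
  by move: sr; rewrite lt_min => /andP[_]; rewrite ltNge s1.
apply: hs; apply: meagerS mV => h [/= Ch hsh]; split.
  by apply: rV; exact: lt_trans sr.
by move=> [_]; exact.
Qed.

End Coordinates.

(** Points are separated through the vanishing of the coordinates: thus the
    sets of zeros of finitely many coordinates shrink to points, and the
    positivity pattern of the coordinates determines a point. *)
Record orbit_coordinates {R : realType} {G : topologicalGroupType} {X : Type}
    (B : set (set X)) (act : G -> X -> X) (a : nat -> X -> R) : Prop := {
  coord_ge0 : forall i x, 0 <= a i x ;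
  coord_measurable : forall i, measurable_real (S := B) (a i) ;
  coord_continuous : forall i x, continuous (fun g => a i (act g x)) ;
  coord_separating : forall x y, (forall i, a i x = 0 -> a i y = 0) -> x = y
}.

Section CoordinatesExist.
Context {R : realType} {G : topologicalGroupType} {d : G -> G -> R}.
Context (dc : compatible_metric d) (dr : right_invariant d).
Context (Gsc : @second_countable G) (Glc : locally_compact [set: G]).
Context {X : Type} {B : set (set X)} {act : G -> X -> X}.
Context (hX : borel_system R B act).

Let mG : is_metric d. Proof. by case: dc. Qed.
Let hB : sigma_algebra setT B.
Proof. exact: standard_borel_sigma_algebra (bs_standard hX). Qed.

Local Notation dist := (hitting_distance (d := d) (act := act)).

(** Some [g] lies outside the countably many meager sets provided by
    [hitting_distance_separates], and there [act g x] and [act g y] are not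
    separated by any [C n]. *)
Lemma hitting_distances_injective (C : nat -> set X) x y :
  (forall n, B (C n)) -> (forall x y, (forall n, C n x -> C n y) -> x = y) ->
  (forall n g, dist (C n) (act g x) = dist (C n) (act g y)) -> x = y.
Proof.
move=> BC Csep hxy.
have /meager_bigcup mS n : meager
    ([set g | C n (act g x)] `\` [set g | C n (act g y)]).
  exact: (hitting_distance_separates dc dr Gsc Glc hX (BC n) (hxy n)).
have [g hg] : exists g, ~ (\bigcup_n
    ([set g | C n (act g x)] `\` [set g | C n (act g y)])) g.
  apply: contrapT => /forallNP h.
  apply: (baire_locally_compact dc Glc (@openT G)); first by exists 1%g.
  by apply: meagerS mS => g _; exact: contrapT (h g).
apply: (act_inj hX (g := g)); apply: Csep => n Cx.
by apply: contrapT => Cy; apply: hg; exists n.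
Qed.

(** The positive and negative parts of [F - q], for [q] rational and [F] a
    hitting distance translated by an element of a countable dense subset of
    [G]. *)
Lemma orbit_coordinates_exist :
  exists a : nat -> X -> R, orbit_coordinates B act a.
Proof.
have [C [BC Csep]] := standard_borel_separating (bs_standard hX).
have [D [_ dD]] := @dense_family_exists G setT Gsc (ex_intro _ 1%g I).
pose c (p : nat * nat * rat * bool) x : R :=
  let r := dist (C p.1.1.1) (act (D p.1.1.2) x) - ratr p.1.2 in
  Num.max 0 (if p.2 then r else - r).
pose a n := if @unpickle (nat * nat * rat * bool)%type n is Some p
  then c p else fun=> 0.
have mdist n k : measurable_real (S := B)
    (fun x => dist (C n) (act (D k) x)).
  move=> e.
  apply: (@measurable_real_act _ _ _ dc Gsc Glc _ _ _ hX (dist (C n))).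
  exact: (measurable_hitting_distance dc Gsc Glc hX (BC n)).
have maxc (s : R) : {homo Num.max s : u v / u <= v}.
  by move=> u v uv; rewrite ge_max le_max lexx le_max uv orbT.
have cdist n k x : continuous (fun g => dist (C n) (act (D k) (act g x))).
  rewrite (_ : (fun _ => _) =
      (fun h => dist (C n) (act h x)) \o (fun g => D k * g)%g).
    move=> g; apply: continuous_comp; first exact: continuous_mulgl.
    apply: (lipschitz_continuous dc).
    exact: (hitting_distance_lipschitz dc dr hX).
  by apply/funext => g /=; rewrite (bs_actM hX).
exists a; split=> [i x|i|i x|x y hxy].
- rewrite /a; case: unpickle => // p; rewrite /c le_max lexx//.
- rewrite /a; case: unpickle => [[[[n k] q] b]|]; last first.
    exact: measurable_real_cst.
  have mr : measurable_real (S := B)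
      (fun x => dist (C n) (act (D k) x) - ratr q).
    apply: (@measurable_real_mono _ _ _ hB (fun r => r - ratr q)
      (fun x => dist (C n) (act (D k) x))) => // u v uv.
    by rewrite lerD2r.
  rewrite /c /=.
  case: b; apply: (@measurable_real_mono _ _ _ hB (Num.max 0)) => //.
  exact: measurable_realN.
- rewrite /a; case: unpickle => [[[[n k] q] b]|]; last first.
    by move=> g; exact: cst_continuous.
  move=> g; rewrite /c /=; apply: continuous_max; first exact: cst_continuous.
  have cr : {for g,
      continuous (fun g => dist (C n) (act (D k) (act g x)) - ratr q)}.
    by apply: continuousB; [exact: cdist|exact: cst_continuous].
  by case: b => //; exact: continuousN.
- apply: (hitting_distances_injective BC Csep) => n.
  have eqD k : dist (C n) (act (D k) x) = dist (C n) (act (D k) y).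
    have hp (q : rat) (b : bool) := hxy (pickle (n, k, q, b)).
    have max0 (r : R) : r <= 0 -> Num.max 0 r = 0 by move=> ?; exact/max_idPl.
    apply/eqP; case: ltgtP => // /rat_between[q q1 q2]; exfalso.
      have := hp q true; rewrite /a pickleK /c /= max0 ?subr_le0 1?ltW//.
      by move=> /(_ erefl) /max_idPl; rewrite subr_le0 leNgt q2.
    have := hp q false.
    rewrite /a pickleK /c /= max0 ?oppr_le0 ?subr_ge0 1?ltW//.
    by move=> /(_ erefl) /max_idPl; rewrite oppr_le0 subr_ge0 leNgt q1.
  move=> g; apply/eqP; rewrite -subr_eq0 -normr_le0; apply/ler_addgt0Pl => e e0.
  have [|k /= Dk] := dD _ (open_mball dc g (e / 2)).
    by exists g; split=> //=; rewrite (metric_xx dc) divr_gt0.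
  have lip z := hitting_distance_lipschitz dc dr hX (C n) z g (D k).
  rewrite addr0 (splitr e).
  apply: le_trans (ler_distD (dist (C n) (act (D k) x)) _ _) _.
  apply: lerD; first exact: le_trans (lip x) (ltW Dk).
  by rewrite eqD distrC; exact: le_trans (lip y) (ltW Dk).
Qed.

End CoordinatesExist.

(** * An injective function, lower semicontinuous along orbits *)

Section Code.
Context {R : realType} {G : topologicalGroupType}.
Context {X : Type} {B : set (set X)} {act : G -> X -> X}.
Context (hB : sigma_algebra setT B).
Context {a : nat -> X -> R} (ha : orbit_coordinates B act a).

(** Partial sums of the number whose ternary digits record which coordinates of
    [x] are positive. With the digits 0 and 1 in base 3, the digits after a
    given place add up to less than a unit of that place. *)
Definition digits_below m x : R := \sum_(n < m) 3^-1 ^+ n.+1 * (0 < a n x)%R%:R.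

(** Replacing each digit by a continuous function of the coordinate makes
    [code] a supremum of functions which are continuous along orbits. *)
Definition soft_digits_below m x : R :=
  \sum_(n < m) 3^-1 ^+ n.+1 * Num.min 1 (m%:R * a n x).

Definition code x : R := sup (range (soft_digits_below ^~ x)).

Lemma digits_belowS m x :
  digits_below m.+1 x = digits_below m x + 3^-1 ^+ m.+1 * (0 < a m x)%R%:R.
Proof. by rewrite /digits_below big_ord_recr. Qed.

Lemma digits_belowD n k x :
  digits_below (n + k) x <=
    digits_below n x + (3^-1 ^+ n - 3^-1 ^+ (n + k)) / 2.
Proof.
elim: k => [|k IH]; first by rewrite addn0 subrr mul0r addr0.
rewrite addnS digits_belowS.
apply: le_trans (lerD IH (_ : _ <= 3^-1 ^+ (n + k).+1)) _.
  by rewrite ler_piMr ?exprn_ge0 ?invr_ge0//; case: (0 < _).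
by rewrite [3^-1 ^+ (n + k).+1]exprS; set p := 3^-1 ^+ (n + k); lra.
Qed.

Lemma digits_below_mono x :
  {homo digits_below ^~ x : m n / (m <= n)%N >-> m <= n}.
Proof.
move=> m n /subnK <-; elim: (n - m)%N => // k IH; apply: le_trans IH _.
by rewrite addSn digits_belowS lerDl mulr_ge0.
Qed.

Lemma digits_below_le n m x :
  digits_below m x <= digits_below n x + 3^-1 ^+ n / 2.
Proof.
apply: le_trans (digits_below_mono x (leq_addl n m)) _.
apply: le_trans (digits_belowD n m x) _.
have : 0 <= 3^-1 ^+ (n + m) :> R by rewrite exprn_ge0 ?invr_ge0.
lra.
Qed.

Lemma soft_digits_le m x : soft_digits_below m x <= digits_below m x.
Proof.
apply: ler_sum => n _; apply: ler_wpM2l; first by rewrite exprn_ge0 ?invr_ge0.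
case: ltP => [_|an]; first by rewrite ge_min lexx.
have -> : a n x = 0 by apply/eqP; rewrite eq_le an (coord_ge0 ha).
by rewrite mulr0 ge_min lexx orbT.
Qed.

Lemma soft_digits_le_half m x : soft_digits_below m x <= 2^-1.
Proof.
apply: le_trans (soft_digits_le m x) _.
apply: le_trans (digits_below_le 0 m x) _.
by rewrite /digits_below big_ord0 add0r expr0 mul1r.
Qed.

Lemma code_leP x c : code x <= c <-> forall m, soft_digits_below m x <= c.
Proof.
split=> [h m|h].
  apply: le_trans h; apply: ub_le_sup; last by exists m.
  by exists 2^-1 => _ [k _ <-]; exact: soft_digits_le_half.
by apply: ge_sup => [|_ [m _ <-]//]; exists (soft_digits_below 0 x), 0%N.
Qed.

Lemma code_ge0 x : 0 <= code x.
Proof.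
by have /code_leP/(_ 0%N) := lexx (code x); rewrite /soft_digits_below big_ord0.
Qed.

Lemma code_le_half x : code x <= 2^-1.
Proof. by apply/code_leP => m; exact: soft_digits_le_half. Qed.

Lemma digits_le_code m x : digits_below m x <= code x.
Proof.
have [j mj hj] : exists2 j, (m <= j)%N &
    forall n, (n < m)%N -> 0 < a n x -> 1 <= j%:R * a n x.
  elim: m => [|m [j mj hj]]; first by exists 0%N.
  have [am|am] := ltP 0 (a m x); last first.
    exists j.+1 => // n; rewrite ltnS leq_eqVlt => /orP[/eqP ->|nm an].
      by rewrite ltNge am.
    by rewrite (le_trans (hj n nm an))// ler_wpM2r ?ler_nat// ltW.
  exists (maxn j.+1 (Num.bound (a m x)^-1)); first by rewrite leq_max ltnS mj.
  move=> n; rewrite ltnS leq_eqVlt => /orP[/eqP -> _|nm an].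
    rewrite -ler_pdivrMr// div1r.
    have := archi_boundP (ltW (_ : 0 < (a m x)^-1)).
    rewrite invr_gt0 => /(_ am)/ltW h.
    by apply: le_trans h _; rewrite ler_nat leq_maxr.
  rewrite (le_trans (hj n nm an))// ler_wpM2r ?(ltW an)// ler_nat.
  by rewrite (leq_trans (leqnSn j))// leq_maxl.
have /code_leP/(_ j) := lexx (code x); apply: le_trans.
rewrite /soft_digits_below -(subnKC mj) big_split_ord /=.
rewrite -[leLHS]addr0; apply: lerD; last first.
  apply: sumr_ge0 => i _; rewrite mulr_ge0 ?exprn_ge0 ?invr_ge0//.
  by rewrite le_min ler01 mulr_ge0// (coord_ge0 ha).
apply: ler_sum => n _; apply: ler_wpM2l; first by rewrite exprn_ge0 ?invr_ge0.
rewrite le_min lern1 leq_b1 /=; case: (ltP 0 (a n x)) => an.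
  by rewrite subnKC//; exact: hj.
by rewrite mulr_ge0// (coord_ge0 ha).
Qed.

Lemma code_inj : injective code.
Proof.
suff digit_le x y : code x = code y -> forall n,
    (forall k, (k < n)%N -> (0 < a k x) = (0 < a k y)) ->
    0 < a n x -> 0 < a n y.
  move=> x y cxy; apply: (coord_separating ha) => n an0.
  have : (0 < a n x) = (0 < a n y).
    elim/ltn_ind: n {an0} => n IH; apply/idP/idP; apply: digit_le => // k kn.
    exact/esym/IH.
  rewrite an0 ltxx => /esym/negbT; rewrite -leNgt => any0.
  by apply/eqP; rewrite eq_le any0 (coord_ge0 ha).
move=> cxy n hn anx; rewrite ltNge; apply/negP => any.
have ux := digits_le_code n.+1 x.
have uy : code y <= digits_below n.+1 y + 3^-1 ^+ n.+1 / 2.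
  apply/code_leP => m.
  exact: le_trans (soft_digits_le m y) (digits_below_le _ _ _).
move: ux uy; rewrite !digits_belowS anx (ltNge _ (a n y)) any /=.
rewrite mulr0 addr0 mulr1 cxy.
rewrite /digits_below
  (eq_bigr (fun i : 'I_n => 3^-1 ^+ i.+1 * (0 < a i y)%R%:R)); last first.
  by move=> i _; rewrite hn.
move=> /le_trans h /h; rewrite lerD2l leNgt => /negP; apply.
by rewrite ltr_pdivrMr// ltr_pMr ?ltr1n// exprn_gt0 ?invr_gt0.
Qed.

Lemma soft_digits_continuous m x :
  continuous (fun g => soft_digits_below m (act g x)).
Proof.
apply: continuous_sum_seq => n g.
apply: (@continuousM _ _ (fun=> 3^-1 ^+ n.+1)
  (fun h => Num.min 1 (m%:R * a n (act h x)))); first exact: cst_continuous.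
apply: continuous_min; first exact: cst_continuous.
by apply: continuousM; [exact: cst_continuous|exact: coord_continuous ha _ _ _].
Qed.

Lemma soft_digits_measurable m : measurable_real (S := B) (soft_digits_below m).
Proof.
apply: (measurable_real_sum hB) => n.
apply: (@measurable_real_mono _ _ _ hB
  (fun r => 3^-1 ^+ n.+1 * Num.min 1 (m%:R * r)) (a n)).
  move=> u v uv; apply: ler_wpM2l; first by rewrite exprn_ge0 ?invr_ge0.
  rewrite le_min ge_min lexx /= ge_min.
  by rewrite (ler_wpM2l _ uv)// orbT.
exact: (coord_measurable ha).
Qed.

End Code.

(** * Lacunary sections *)

Section Lacunary.
Context {R : realType} {G : topologicalGroupType} {d : G -> G -> R}.
Context (dc : compatible_metric d) (dr : right_invariant d).
Context (Gsc : @second_countable G) (Glc : locally_compact [set: G]).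
Context {X : Type} {B : set (set X)} {act : G -> X -> X}.
Context (hX : borel_system R B act).
Context {a : nat -> X -> R} (ha : orbit_coordinates B act a).
Context {eps : R} (eps0 : 0 < eps).

Definition length_ball r : set G := [set g | d g 1%g <= r].
Context (ceps : compact (length_ball (3 * eps))).

Let mG : is_metric d. Proof. by case: dc. Qed.
Let hB : sigma_algebra setT B.
Proof. exact: standard_borel_sigma_algebra (bs_standard hX). Qed.

Lemma compact_length_ball r : r <= 3 * eps -> compact (length_ball r).
Proof.
move=> r3; apply: (subclosed_compact _ ceps).
  rewrite (_ : length_ball r = [set g | d 1%g g <= r]).
    exact: (@closed_mball _ _ _ dc).
  by apply/funext => g; rewrite /length_ball /= (metric_symmetric mG).
by move=> g /le_trans; exact.
Qed.

Lemma length_ball1 r : 0 <= r -> length_ball r 1%g.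
Proof. by rewrite /length_ball /= (metric_xx dc). Qed.

Lemma length_ballV r g : length_ball r g -> length_ball r g^-1%g.
Proof. by rewrite /length_ball /= (length_invg dc dr). Qed.

Lemma length_ballM r s g h : length_ball r g -> length_ball s h ->
  length_ball (r + s) (g * h)%g.
Proof.
by move=> gr hs; apply: le_trans (length_mulg dc dr g h) (lerD gr hs).
Qed.

Definition window (l : seq nat) : set X := [set y | \sum_(i <- l) a i y <= 0].

Lemma windowP l y : window l y <-> forall i, i \in l -> a i y = 0.
Proof.
rewrite /window /=; elim: l => [|i l IH]; first by rewrite big_nil lexx.
rewrite big_cons; have ai := coord_ge0 ha i y.
have sl : 0 <= \sum_(j <- l) a j y.
  by apply: sumr_ge0 => j _; exact: coord_ge0 ha _ _.
split=> [h j|h].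
  rewrite inE => /orP[/eqP ->|jl]; last first.
    by apply: IH.1 jl; rewrite (le_trans _ h)// lerDr.
  by apply/eqP; rewrite eq_le ai andbT (le_trans _ h)// lerDl.
rewrite (h i) ?mem_head// add0r; apply: IH.2 => j jl.
by apply: h; rewrite inE jl orbT.
Qed.

Lemma window_continuous l x :
  continuous (fun g => \sum_(i <- l) a i (act g x)).
Proof.
by apply: continuous_sum_seq => i; exact: coord_continuous ha _ _.
Qed.

Lemma window_measurable l :
  measurable_real (S := B) (fun x => \sum_(i <- l) a i x).
Proof.
by apply: (measurable_real_sum hB) => i; exact: coord_measurable ha _.
Qed.

(** The code is only lower semicontinuous along orbits; bounding it from above
    is written here as countably many inequalities between continuous
    functions, the form to which compactness arguments apply. *)
Definition low_code l c (i : option nat) y : R :=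
  if i is Some m then soft_digits_below (a := a) m y - c
  else \sum_(i <- l) a i y.

Lemma low_codeP l c y :
  (forall i, low_code l c i y <= 0) <-> window l y /\ code (a := a) y <= c.
Proof.
split=> [h|[wy /(code_leP ha) cy] [m|] //=]; last by rewrite subr_le0.
split; first exact: (h None).
by apply/(code_leP ha) => m; have := h (Some m); rewrite /= subr_le0.
Qed.

Lemma low_code_continuous l c i x :
  continuous (fun g => low_code l c i (act g x)).
Proof.
case: i => [m|] /=; last exact: window_continuous.
move=> g; apply: continuousB; last exact: cst_continuous.
exact: (soft_digits_continuous ha).
Qed.

Lemma low_code_measurable l (c : X -> R) i (f : X -> X) :
  (forall u : X -> R, measurable_real (S := B) u ->
     measurable_real (S := B) (u \o f)) ->
  measurable_real (S := B) c ->
  measurable_real (S := B) (fun x => low_code l (c x) i (f x)).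
Proof.
move=> mf mc; case: i => [m|] /=.
  apply: (measurable_realD hB); last exact: (measurable_realN hB).
  exact: mf (soft_digits_measurable hB ha m).
exact: mf (window_measurable l).
Qed.

Let act_measurable g (u : X -> R) : measurable_real (S := B) u ->
  measurable_real (S := B) (u \o act g).
Proof. exact: (measurable_real_act dc Gsc Glc hX). Qed.

Let dense_ball r : 0 <= r ->
  exists D : nat -> G, dense_family (length_ball r) D.
Proof.
move=> r0; apply: (dense_family_exists Gsc).
by exists 1%g; exact: length_ball1.
Qed.

Definition reaches l r c : set X := [set z | exists2 v, length_ball r v &
  window l (act v z) /\ code (a := a) (act v z) <= c].

Lemma reaches_measurable l r (c : X -> R) : 0 <= r -> r <= 3 * eps ->
  measurable_real (S := B) c -> B [set z | reaches l r (c z) z].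
Proof.
move=> r0 r3 mc; have [D hD] := dense_ball r0.
rewrite (_ : mkset _ = [set z | exists2 v, length_ball r v &
    forall i, low_code l (c z) i (act v z) <= 0]).
  apply: (sigma_compact_projection hB
    (P := fun i v z => low_code l (c z) i (act v z))
    (compact_length_ball r3) hD) => [i z|i v].
    exact: low_code_continuous.
  by apply: low_code_measurable => // u mu; exact: act_measurable.
by apply/seteqP; split=> z [v rv] /low_codeP; exists v.
Qed.

(** The value 1 exceeds every code and marks the points whose orbit misses the
    window near them. *)
Definition min_code l z := inf [set c | c = 1 \/ exists2 v,
  length_ball eps v & window l (act v z) /\ code (a := a) (act v z) = c].

Lemma min_code_le l z v : length_ball eps v -> window l (act v z) ->
  min_code l z <= code (a := a) (act v z).
Proof.
move=> ve wv; apply: ge_inf; last by right; exists v.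
by exists 0 => _ [->|[u _ [_ <-]]]; [exact: ler01|exact: (code_ge0 ha)].
Qed.

Lemma min_code_lt l z c : c <= 1 -> min_code l z < c ->
  exists2 v, length_ball eps v &
    window l (act v z) /\ code (a := a) (act v z) < c.
Proof.
move=> c1 /inf_lt[|b]; first by exists 1; left.
by case=> [->|[v ve [wv <-]]] bc; [move: bc; rewrite ltNge c1|exists v].
Qed.

Lemma min_code_attained l z : reaches l eps 1 z ->
  exists2 v, length_ball eps v &
    window l (act v z) /\ code (a := a) (act v z) = min_code l z.
Proof.
move=> [w we [ww _]].
have m1 : min_code l z < 1.
  apply: le_lt_trans (min_code_le we ww) _.
  by apply: le_lt_trans (code_le_half ha _) _; rewrite invf_lt1// ltr1n.
have e3 : eps <= 3 * eps by rewrite ler_peMl ?ltW// ltr1n.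
have [|v ve /low_codeP[wv cv]] := @compact_approx R G _ (length_ball eps)
    (fun i v => low_code l (min_code l z) i (act v z))
    (compact_length_ball e3) (fun i => @low_code_continuous l _ i z).
  move=> n.
  have [||v ve [wv cv]] := @min_code_lt l z
      (Num.min 1 (min_code l z + n.+1%:R^-1)) _.
  - by rewrite ge_min lexx.
  - by rewrite lt_min m1 ltrDl invr_gt0 ltr0n.
  exists v; split=> // -[m _|_] /=; last first.
    by rewrite (le_trans wv)// invr_ge0 ler0n.
  rewrite lerBlDl; move: cv; rewrite lt_min => /andP[_ /ltW].
  by move/(code_leP ha)/(_ m).
exists v => //; split=> //.
by apply/eqP; rewrite eq_le cv min_code_le.
Qed.

Let epsW n : (n <= 3)%N -> n%:R * eps <= 3 * eps.
Proof. by move=> n3; rewrite ler_pM2r// ler_nat. Qed.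

Let eps3 : eps <= 3 * eps. Proof. by have := @epsW 1 isT; rewrite mul1r. Qed.

Lemma min_code_measurable l : measurable_real (S := B) (min_code l).
Proof.
move=> c; have [c1|c1] := leP c 1; last first.
  rewrite (_ : mkset _ = [set _ | True]); first exact: (sigma_const hB).
  apply/seteqP; split=> z //= _; apply: le_lt_trans c1; apply: ge_inf.
    by exists 0 => _ [->|[u _ [_ <-]]]; [exact: ler01|exact: (code_ge0 ha)].
  by left.
rewrite (_ : mkset _ = [set z | exists q : rat,
    reaches l eps (ratr q) z /\ ratr q < c]).
  apply: (sigma_ex hB) => q.
  apply: (sigma_setI hB); last exact: (sigma_const hB).
  apply: (@reaches_measurable l eps (fun=> ratr q)) => //; first exact: ltW.
  exact: (measurable_real_cst hB).
apply/seteqP; split=> z /=.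
  move=> /(min_code_lt c1)[v ve [wv /rat_between[q cq qc]]].
  by exists q; split=> //; exists v => //; split=> //; exact: ltW.
move=> [q [[v ve [wv cv]] qc]].
by apply: le_lt_trans (min_code_le ve wv) _; exact: le_lt_trans qc.
Qed.

(** Minimality of the code is a local condition on the orbit which selects one
    point from each cluster of points of the window: as codes are injective,
    two such minima cannot be close on an orbit unless they coincide. *)
Definition lacunary_points l : set X := [set y | window l y /\
  forall v, length_ball (2 * eps) v -> window l (act v y) ->
    code (a := a) y <= code (a := a) (act v y)].

Lemma lacunary_points_eq l y g : length_ball (2 * eps) g ->
  lacunary_points l y -> lacunary_points l (act g y) -> act g y = y.
Proof.
move=> ge [wy my] [wg mg]; apply: (code_inj ha); apply/eqP.
rewrite eq_le my// andbT.
have := mg g^-1%g (length_ballV ge); rewrite (actK hX); exact.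
Qed.

Lemma lacunary_points_min_code l z u : length_ball eps u ->
  lacunary_points l (act u z) -> code (a := a) (act u z) = min_code l z.
Proof.
move=> ue [wu mu]; have rz : reaches l eps 1 z.
  exists u => //; split=> //; apply: le_trans (code_le_half ha _) _.
  by rewrite invf_le1// ler1n.
have [v ve [wv cv]] := min_code_attained rz.
apply/eqP; rewrite eq_le min_code_le// andbT -cv.
have := mu (v * u^-1)%g; rewrite (act_divg hX); apply => //.
by rewrite mulr2n mulrDl mul1r; exact: length_ballM (length_ballV ue).
Qed.

(** A lacunary point within distance [eps] has the minimal code [min_code l z];
    conversely, a point realizing this minimum is lacunary unless some point at
    distance at most [2 * eps] from it has a smaller code. Only compact sets of
    group elements occur on the right-hand side. *)
Lemma near_lacunary_pointP l z :
  (exists2 u, length_ball eps u & lacunary_points l (act u z)) <->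
  reaches l eps 1 z /\
  forall u v, length_ball eps u -> length_ball (2 * eps) v ->
    window l (act u z) -> code (a := a) (act u z) <= min_code l z ->
    window l (act v (act u z)) ->
    min_code l z <= code (a := a) (act v (act u z)).
Proof.
split=> [[w we Yw]|[rz h]].
  have cw := lacunary_points_min_code we Yw.
  split.
    exists w => //; split; first exact: Yw.1.
    by apply: le_trans (code_le_half ha _) _; rewrite invf_le1// ler1n.
  move=> u v ue ve wu cu; have -> : act u z = act w z.
    apply: (code_inj ha); apply/eqP; rewrite eq_le {1}cw cu /= cw.
    exact: min_code_le.
  by rewrite -cw; exact: Yw.2.
have [u ue [wu cu]] := min_code_attained rz.
exists u => //; split=> // v ve wv; rewrite cu; apply: h => //.
by rewrite cu.
Qed.

Lemma near_lacunary_point_measurable l :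
  B [set z | exists2 u, length_ball eps u & lacunary_points l (act u z)].
Proof.
(* The rational q lies between the minimal code and a smaller code found at
   a distance at most 2 * eps from the minimum. *)
pose bad (q : rat) : set X := [set z | exists2 p : G * G,
  (length_ball eps `*` length_ball (2 * eps)) p &
  forall i, (match i with
    | inl i => low_code l (min_code l z) i (act p.1 z)
    | inr i => low_code l (ratr q) i (act p.2 (act p.1 z))
    end) <= 0].
rewrite (_ : mkset _ = [set z | reaches l eps 1 z] `&`
    ~` [set z | exists q : rat, bad q z /\ ratr q < min_code l z]).
  apply: (sigma_setI hB).
    apply: (@reaches_measurable l eps (fun=> 1)) => //; first exact: ltW.
    exact: (measurable_real_cst hB).
  apply: (sigma_setC hB); apply: (sigma_ex hB) => q.
  apply: (sigma_setI hB); last first.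
    exact: (measurable_real_gt hB _ (min_code_measurable l)).
  have e2 : 0 <= 2 * eps by rewrite mulr_ge0// ltW.
  have [D1 hD1] := dense_ball (ltW eps0).
  have [D2 hD2] := dense_ball e2.
  have cK : compact (length_ball eps `*` length_ball (2 * eps)).
    by apply: compact_setX; apply: compact_length_ball => //; exact: (@epsW 2).
  apply: (@sigma_compact_projection R X B hB (G * G)%type
    (option nat + option nat)%type (nat * nat)%type _ _
    (fun i p z => match i with
    | inl i => low_code l (min_code l z) i (act p.1 z)
    | inr i => low_code l (ratr q) i (act p.2 (act p.1 z))
    end) cK (dense_familyX hD1 hD2)).
    move=> [i|i] z p.
      apply: (@continuous_comp _ _ _ fst
        (fun g => low_code l (min_code l z) i (act g z))); first exact: cvg_fst.
      exact: low_code_continuous.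
    rewrite (_ : (fun _ => _) = (fun g => low_code l (ratr q) i (act g z)) \o
      (fun p : G * G => p.2 * p.1)%g).
      apply: continuous_comp; last exact: low_code_continuous.
      apply: (@continuous2_cvg _ _ _ _ _ _ snd fst (fun x y : G => (x * y)%g)).
      - exact: (@mulg_continuous G (p.2, p.1)).
      - exact: cvg_snd.
      - exact: cvg_fst.
    by apply/funext => -[g h] /=; rewrite (bs_actM hX).
  move=> [i|i] p.
    apply: low_code_measurable (min_code_measurable l) => u.
    exact: act_measurable.
  apply: (@low_code_measurable l (fun=> ratr q) i
    (fun z => act p.2 (act p.1 z))).
    move=> u mu; exact: act_measurable (act_measurable p.2 mu).
  exact: (measurable_real_cst hB).
apply/seteqP; split=> z /=.
  move/near_lacunary_pointP => [rz h]; split=> // -[q [[[u v] [/= ue ve] hi]]].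
  have /low_codeP[wu cu] := fun i => hi (inl i).
  have /low_codeP[wv cv] := fun i => hi (inr i).
  by rewrite ltNge => /negP; apply; apply: le_trans cv; exact: h.
move=> [rz nb]; apply/near_lacunary_pointP; split=> // u v ue ve wu cu wv.
rewrite leNgt; apply/negP => /rat_between[q cq qm]; apply: nb; exists q.
split=> //; exists (u, v) => // -[i|i] /=.
  by move: i; apply/low_codeP.
by move: i; apply/low_codeP; split=> //; exact: ltW.
Qed.

(** Heights stay below [eps], so that only the points of [Y] within distance
    [eps] along the orbit have a peak visible from a given point; being at
    least [eps / 2], they are also detected from a dense set of translates. *)
Definition height y : R := eps / 2 * (1 + code (a := a) y).

(** Along the orbit of [z], this is a family of cones of slope one whose
    summits lie over the points of [Y] in the orbit. *)
Definition peaks (Y : set X) z : R := sup [set r | r = 0 \/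
  exists2 u, Y (act u z) & r = height (act u z) - d u 1%g].

Lemma height_gt0 y : 0 < height y.
Proof.
by rewrite mulr_gt0 ?divr_gt0// ltr_pwDl// (code_ge0 ha).
Qed.

Lemma height_lt y : height y < eps.
Proof.
have := code_le_half ha y; have := eps0; rewrite /height.
set c := code y; nra.
Qed.

Lemma height_inj : injective height.
Proof.
move=> x y /mulfI h; apply: (code_inj ha); apply: (@addrI _ 1); apply: h.
by rewrite gt_eqF// divr_gt0.
Qed.

Let peaks_sup Y z : has_sup [set r | r = 0 \/
  exists2 u, Y (act u z) & r = height (act u z) - d u 1%g].
Proof.
split; first by exists 0; left.
exists eps => _ [->|[u _ ->]]; first exact: ltW.
by rewrite lerBlDr (le_trans (ltW (height_lt _)))// lerDl (metric_ge0 dc).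
Qed.

Lemma peaks_ge0 Y z : 0 <= peaks Y z.
Proof. by apply: ub_le_sup; [case: (peaks_sup Y z)|left]. Qed.

Lemma peaks_ge Y z u : Y (act u z) -> height (act u z) - d u 1%g <= peaks Y z.
Proof.
by move=> Yu; apply: ub_le_sup; [case: (peaks_sup Y z)|right; exists u].
Qed.

Lemma peaks_le Y z c : 0 <= c ->
  (forall u, Y (act u z) -> height (act u z) - d u 1%g <= c) -> peaks Y z <= c.
Proof.
move=> c0 hc; apply: ge_sup; first by exists 0; left.
by move=> _ [->//|[u /hc h ->]].
Qed.

Lemma peaks_gtP Y z c : 0 <= c -> c < peaks Y z <->
  exists2 u, Y (act u z) & c < height (act u z) - d u 1%g.
Proof.
move=> c0; split=> [h|[u Yu cu]]; last exact: lt_le_trans (peaks_ge Yu).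
apply: contrapT => hno; move: h; rewrite ltNge => /negP; apply.
apply: peaks_le => // u Yu; rewrite leNgt; apply/negP => cu.
by apply: hno; exists u.
Qed.

Lemma peaks_le_eps Y z : peaks Y z <= eps.
Proof.
apply: peaks_le => [|u _]; first exact: ltW.
by rewrite lerBlDr (le_trans (ltW (height_lt _)))// lerDl (metric_ge0 dc).
Qed.

Lemma peaks_lipschitz Y z g h :
  `|peaks Y (act g z) - peaks Y (act h z)| <= d g h.
Proof.
suff le_ k1 k2 : peaks Y (act k1 z) <= peaks Y (act k2 z) + d k1 k2.
  by rewrite ler_distl lerBlDr le_ (metric_symmetric mG) le_.
apply: peaks_le => [|u Yu].
  by rewrite addr_ge0 ?peaks_ge0 ?(metric_ge0 dc).
have E : act u (act k1 z) = act (u * (k1 * k2^-1))%g (act k2 z).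
  by rewrite (bs_actM hX u) (act_divg hX).
rewrite E in Yu *; rewrite -lerBlDr; apply: le_trans (peaks_ge Yu).
rewrite -addrA -opprD lerD2l lerN2 (metric_divg dr k1).
exact: length_mulg.
Qed.

(** Only the lacunary points at distance at most [eps] contribute to [peaks],
    and there is at most one of them: the point of minimal code in the window.
    *)
Lemma peaks_gt_lacunaryP l z c : 0 <= c ->
  c < peaks (lacunary_points l) z <->
  (exists2 u, length_ball eps u & lacunary_points l (act u z)) /\
  exists q : rat, ((0 <= ratr q :> R) /\ (ratr q <= eps)) /\
    (c + ratr q < eps / 2 * (1 + min_code l z) /\
     reaches l (ratr q) (min_code l z) z).
Proof.
move=> c0; split.
  move/(peaks_gtP _ _ c0) => [u Yu]; rewrite ltrBrDr -ltrBrDl => uc.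
  have ue : length_ball eps u.
    rewrite /length_ball /= (le_trans (ltW uc))// lerBlDr.
    by rewrite (le_trans (ltW (height_lt _)))// lerDl.
  have cu := lacunary_points_min_code ue Yu.
  split; first by exists u.
  have [q uq qc] := rat_between uc.
  exists q; split; last split.
  - rewrite (le_trans (metric_ge0 dc _ _) (ltW uq)); split=> //.
    rewrite (le_trans (ltW qc))// lerBlDr.
    by rewrite (le_trans (ltW (height_lt _)))// lerDl.
  - by rewrite -cu -ltrBrDl.
  - by exists u; [exact: ltW|split; [exact: Yu.1|rewrite cu]].
move=> [[w we Yw] [q [[q0 qe] [cq [u uq [wu cu]]]]]].
have ue : length_ball eps u by exact: le_trans uq qe.
have cw := lacunary_points_min_code we Yw.
have E : act u z = act w z.
  by apply: (code_inj ha); apply/eqP; rewrite eq_le {1}cw cu /= cw min_code_le.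
apply/(peaks_gtP _ _ c0); exists u; first by rewrite E.
rewrite E /height cw ltrBrDr; apply: le_lt_trans cq.
by rewrite lerD2l.
Qed.

Lemma peaks_lacunary_measurable l :
  measurable_real (S := B) (peaks (lacunary_points l)).
Proof.
apply: (measurable_real_of_gt hB) => c; have [c0|c0] := ltP c 0.
  rewrite (_ : mkset _ = [set _ | True]); first exact: (sigma_const hB).
  by apply/seteqP; split=> z //= _; apply: lt_le_trans c0 (peaks_ge0 _ _).
rewrite (_ : mkset _ = [set z | (exists2 u, length_ball eps u &
  lacunary_points l (act u z)) /\
  exists q : rat, ((0 <= ratr q :> R) /\ (ratr q <= eps)) /\
    (c + ratr q < eps / 2 * (1 + min_code l z) /\
     reaches l (ratr q) (min_code l z) z)]); last first.
  by apply/seteqP; split=> z /(peaks_gt_lacunaryP _ _ c0).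
apply: (sigma_setI hB); first exact: near_lacunary_point_measurable.
apply: (sigma_ex hB) => q.
have [[q0 qe]|nq] := pselect ((0 <= ratr q :> R) /\ (ratr q <= eps));
  last first.
  rewrite (_ : mkset _ = [set _ | False]); first exact: (sigma_const hB).
  by apply/seteqP; split=> z //= -[].
apply: (sigma_setI hB); first exact: (sigma_const hB).
apply: (sigma_setI hB).
  apply: (measurable_real_gt hB); apply: (@measurable_real_mono _ _ _ hB
    (fun r => eps / 2 * (1 + r)) (min_code l)) (min_code_measurable l).
  by move=> r s rs; rewrite ler_pM2l ?divr_gt0// lerD2l.
apply: (reaches_measurable _ q0 _ (min_code_measurable l)).
exact: le_trans eps3.
Qed.

(** Windows shrinking to a point [x] eventually isolate [x] in a compact piece
    of its orbit, up to small group elements: otherwise points [act (v n) x]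
    far from [x] along the orbit would accumulate, by compactness, at some [act
    v x] satisfying [act v x = x], and [v n / v] would be a small element
    taking [x] to [act (v n) x]. *)
Lemma isolating_window x : exists l, window l x /\
  forall v, length_ball (3 * eps) v -> window l (act v x) ->
    exists2 u, length_ball eps u & act u x = act v x.
Proof.
apply: contrapT => /forallNP hno.
pose l m := [seq i <- iota 0 m | a i x == 0].
have /choice[v hv] m : exists v, [/\ length_ball (3 * eps) v,
    window (l m) (act v x) &
    forall u, length_ball eps u -> act u x <> act v x].
  apply: contrapT => /forallNP h; apply: (hno (l m)); split.
    by apply/windowP => i; rewrite mem_filter => /andP[/eqP].
  move=> v v3 wv; apply: contrapT => hu; apply: (h v); split=> // u ue E.
  by apply: hu; exists u.
have v3 n : length_ball (3 * eps) (v n) by case: (hv n).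
have [w _ hw] := compact_seq_cluster ceps v3.
have wx : x = act w x.
  apply: (coord_separating ha) => i ai0; apply/eqP.
  rewrite eq_le (coord_ge0 ha) andbT leNgt; apply/negP => awi.
  have oU : open ((fun g => a i (act g x)) @^-1` [set r | 0 < r]).
    apply: open_comp => [g _|]; last exact: open_gt.
    exact: (coord_continuous ha).
  have [n ni /= an] := hw _ oU awi i.+1.
  have [_ /windowP/(_ i) + _] := hv n.
  rewrite mem_filter ai0 eqxx mem_iota /= add0n ni => /(_ isT) an0.
  by rewrite an0 ltxx in an.
have [|n _ /= vn] := hw _ (open_mball dc w eps) _ 0%N.
  by rewrite /= (metric_xx dc).
have [_ _ /(_ (v n * w^-1)%g)] := hv n; apply.
  by rewrite /length_ball /= -(metric_divg dr) (metric_symmetric mG) ltW.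
by rewrite {1}wx (act_divg hX).
Qed.

(** In a window isolating [x], the point of minimal code within [eps] of [x] is
    minimal among all points of the window at distance at most [3 * eps] from
    [x], hence among those at distance at most [2 * eps] from itself. *)
Lemma lacunary_points_meet x : exists l g, lacunary_points l (act g x).
Proof.
have [l [wx hl]] := isolating_window x; exists l.
have [|u ue [wu cu]] := @min_code_attained l x.
  exists 1%g; first by apply: length_ball1; exact: ltW.
  rewrite (bs_act1 hX); split=> //; apply: le_trans (code_le_half ha _) _.
  by rewrite invf_le1// ler1n.
exists u; split=> // v ve; rewrite -(bs_actM hX) => wvu.
have [|u' u'e E] := hl _ _ wvu.
  by rewrite -[3]natr1 mulrDl mul1r; exact: length_ballM.
by rewrite -E cu; apply: min_code_le => //; rewrite E.
Qed.

Definition nth_points j := lacunary_points (odflt [::] (unpickle j)).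

Definition meets j x := exists g, nth_points j (act g x).

(** On each orbit, keep the points attached to the first window for which there
    are any. *)
Definition section_points : set X := [set y | exists2 j, nth_points j y &
  forall i, (i < j)%N -> ~ meets i y].

Lemma meets_act j g x : meets j (act g x) <-> meets j x.
Proof.
split=> -[h]; last first.
  by exists (h * g^-1)%g; rewrite (act_divg hX).
by rewrite -(bs_actM hX) => ?; exists (h * g)%g.
Qed.

Lemma section_points_eq y g : length_ball (2 * eps) g ->
  section_points y -> section_points (act g y) -> act g y = y.
Proof.
move=> ge [j Yj hj] [k Yk hk]; have jk : j = k.
  apply/eqP; case: ltngtP => // [/hk|/hj]; case.
    by apply/meets_act; exists 1%g; rewrite (bs_act1 hX).
  by exists g.
by rewrite -jk in Yk; exact: lacunary_points_eq Yk.
Qed.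

Lemma section_points_meet x : exists g, section_points (act g x).
Proof.
have [l [g Yg]] := lacunary_points_meet x.
have exj : exists j, `[< meets j x >].
  by exists (pickle l); apply/asboolP; exists g; rewrite /nth_points pickleK.
case: (ex_minnP exj) => j /asboolP[h Yh] minj.
exists h; exists j => // i ij /meets_act mi.
by have := minj i (asboolT mi); rewrite leqNgt ij.
Qed.

(** The orbit meets the lacunary points iff one of their peaks is visible, and
    by continuity it is then visible from a translate by an element of a
    countable dense set. *)
Lemma meets_peaksP (D : nat -> G) j z : dense_family setT D ->
  meets j z <-> exists k, 0 < peaks (nth_points j) (act (D k) z).
Proof.
move=> [_ dD].
split=> [[g Yg]|[k /(peaks_gtP _ _ (lexx 0))[u Yu _]]]; last first.
  by exists (u * D k)%g; rewrite (bs_actM hX).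
have [|k /= Dk] := dD _ (open_mball dc g (eps / 2)).
  by exists g; split=> //=; rewrite (metric_xx dc) divr_gt0.
exists k; apply/(peaks_gtP _ _ (lexx 0)).
exists (g * (D k)^-1)%g; rewrite (act_divg hX)// subr_gt0 -(metric_divg dr).
apply: lt_le_trans Dk _; apply: ler_peMr; first by rewrite divr_ge0// ltW.
by rewrite lerDl (code_ge0 ha).
Qed.

Lemma peaks_section_measurable :
  measurable_real (S := B) (peaks section_points).
Proof.
have [D hD] := @dense_family_exists G setT Gsc (ex_intro _ 1%g I).
have mm j : B [set z | meets j z].
  rewrite (_ : mkset _ =
      [set z | exists k, 0 < peaks (nth_points j) (act (D k) z)]).
    apply: (sigma_ex hB) => k; apply: (measurable_real_gt hB).
    exact: act_measurable (peaks_lacunary_measurable _).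
  by apply/seteqP; split=> z /(meets_peaksP j z hD).
apply: (measurable_real_of_gt hB) => c; have [c0|c0] := ltP c 0.
  rewrite (_ : mkset _ = [set _ | True]); first exact: (sigma_const hB).
  by apply/seteqP; split=> z //= _; apply: lt_le_trans c0 (peaks_ge0 _ _).
rewrite (_ : mkset _ = [set z | exists j,
    (forall i : nat, (i < j)%N -> ~ meets i z) /\ c < peaks (nth_points j) z]).
  apply: (sigma_ex hB) => j; apply: (sigma_setI hB); last first.
    exact: (measurable_real_gt hB _ (peaks_lacunary_measurable _)).
  apply: (sigma_all hB) => i; case: (ltnP i j) => ij.
    rewrite (_ : mkset _ = ~` [set z | meets i z]).
      exact: (sigma_setC hB).
    by apply/seteqP; split=> z /=; [apply|move=> ?].
  rewrite (_ : mkset _ = [set _ | True]); first exact: (sigma_const hB).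
  by apply/seteqP; split.
apply/seteqP; split=> z /=.
  move=> /(peaks_gtP _ _ c0)[u [j Yj hj] cu]; exists j; split.
    by move=> i /hj h m; apply: h; apply/meets_act.
  by apply/(peaks_gtP _ _ c0); exists u.
move=> [j [hj /(peaks_gtP _ _ c0)[u Yu cu]]]; apply/(peaks_gtP _ _ c0).
by exists u => //; exists j => // i /hj h /meets_act.
Qed.

Lemma peaks_le_near p u : section_points p -> length_ball eps u ->
  peaks section_points (act u p) <= height p.
Proof.
move=> Yp ue; apply: peaks_le => [|w Yw]; first exact: ltW (height_gt0 p).
have [we|we] := leP (d w 1%g) eps.
  rewrite -(bs_actM hX) in Yw *.
  rewrite (section_points_eq _ Yp Yw) ?gerBl ?(metric_ge0 dc)//.
  by rewrite mulr2n mulrDl mul1r; exact: length_ballM.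
apply: (le_trans _ (ltW (height_gt0 p))); rewrite subr_le0.
exact: ltW (lt_trans (height_lt _) we).
Qed.

Lemma peaks_on_section p :
  section_points p -> peaks section_points p = height p.
Proof.
move=> Yp; apply/eqP; rewrite eq_le; apply/andP; split.
  have := peaks_le_near Yp (length_ball1 (ltW eps0)).
  by rewrite (bs_act1 hX).
have := @peaks_ge section_points p 1%g.
by rewrite (bs_act1 hX) (metric_xx dc) subr0; apply.
Qed.

(** The height function along an orbit determines its peaks, hence one point of
    the section and its position on the orbit; stabilizers being closed, this
    is enough to recover the base point. *)
Lemma peaks_injective x y :
  (forall g, peaks section_points (act g x) = peaks section_points (act g y)) ->
  x = y.
Proof.
move=> hxy; have [u Yp] := section_points_meet x.
apply: (act_inj hX (g := u)); set p := act u x in Yp *; set q := act u y.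
have hpq g : peaks section_points (act g p) = peaks section_points (act g q).
  by rewrite -!(bs_actM hX).
have near_q delta : 0 < delta -> delta <= height p -> exists w,
    [/\ section_points (act w q), length_ball eps w &
        height p - delta < height (act w q) - d w 1%g].
  move=> delta0 deltap.
  have [] := peaks_gtP section_points q (c := height p - delta) _.
    by rewrite subr_ge0.
  have := hpq 1%g; rewrite !(bs_act1 hX) peaks_on_section// => <-.
  rewrite gtrBl => /(_ delta0)[w Yw hw] _; exists w; split=> //.
  have hq := height_lt (act w q).
  by rewrite /length_ball /=; lra.
have [w0 [Yq' w0e _]] := near_q _ (height_gt0 p) (lexx _).
set q' := act w0 q in Yq'.
(* All near-optimal points seen from q coincide, by lacunarity. *)
have small delta : 0 < delta -> delta <= height p -> exists w,
    [/\ act w q = q', d w 1%g < delta & height p - delta < height q'].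
  move=> delta0 /(near_q _ delta0)[w [Yw we hw]].
  have wq : act w q = q'.
    rewrite -(act_divg hX w w0 q); apply: section_points_eq => //.
      by rewrite mulr2n mulrDl mul1r; exact: length_ballM (length_ballV w0e).
    by rewrite (act_divg hX).
  rewrite wq in hw; have q'p : height q' <= height p.
    by rewrite -(peaks_on_section Yq') -wq -hpq; exact: peaks_le_near.
  have := metric_ge0 dc w 1%g => w0'.
  by exists w; split=> //; lra.
have pq' : p = q'.
  apply: height_inj; apply/eqP; rewrite eq_le; apply/andP; split.
    apply/ler_addgt0Pr => e e0.
    have [||w [_ _]] := small (Num.min e (height p)).
    - by rewrite lt_min e0 height_gt0.
    - by rewrite ge_min lexx orbT.
    have : Num.min e (height p) <= e by rewrite ge_min lexx.
    lra.
  by rewrite -(peaks_on_section Yq') -hpq; exact: peaks_le_near.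
(* The points act w q, for suitable w tending to 1, are all equal to p. *)
apply/esym; apply: (coord_separating ha) => i aq0; apply/eqP.
rewrite eq_le (coord_ge0 ha) andbT leNgt; apply/negP => ap0.
have oU : open ((fun g => a i (act g q)) @^-1` [set r | r < a i p]).
  by apply: open_comp => [g _|]; [exact: (coord_continuous ha)|exact: open_lt].
have [|e e0 hU] := open_metric dc oU (x := 1%g).
  by rewrite /= (bs_act1 hX) aq0.
have [||w [wq we _]] := small (Num.min e (height p)).
- by rewrite lt_min e0 height_gt0.
- by rewrite ge_min lexx orbT.
have /hU/= : d 1%g w < e.
  by rewrite (metric_symmetric mG) (lt_le_trans we)// ge_min lexx.
by rewrite wq -pq' ltxx.
Qed.

End Lacunary.

(** * Borel sets of the space of Lipschitz functions *)

Section LipschitzBorel.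
Context {R : realType} {G : topologicalGroupType} {d : G -> G -> R}.
Context (dc : compatible_metric d) (Gsc : @second_countable G).
Context {D : nat -> G} (hD : dense_family setT D).

Let mG : is_metric d. Proof. by case: dc. Qed.

Definition box (l : seq (nat * rat * rat)) : set (G -> R) :=
  [set f | forall p, p \in l -> ratr p.1.2 < f (D p.1.1) < ratr p.2].

(** On [Lip1 d] the compact-open topology is generated by the conditions on the
    values at the points of a countable dense set: otherwise functions [h n]
    subject to more and more of the conditions satisfied by [f] would violate a
    compact-open condition satisfied by [f] at points [k n] of a compact set,
    which a cluster point of the [k n] forbids. *)
Lemma compact_open_Lip1_box (f : {compact-open, G -> R})
    (V : set {compact-open, G -> R}) :
  Lip1 d f -> open V -> V f ->
  exists l, box l f /\ (forall h, Lip1 d h -> box l h -> V h).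
Proof.
move=> [f01 fd] oV Vf.
(* It suffices that the filter generated by the boxes around f tends to f. *)
pose F : set_system {compact-open, G -> R} :=
  [set A | exists l, box l f /\ (forall h, Lip1 d h -> box l h -> A h)].
have FF : Filter F.
  split.
  - by exists [::]; split.
  - move=> A A' [l [lf lA]] [l' [l'f l'A]]; exists (l ++ l'); split.
      by move=> p; rewrite mem_cat => /orP[/lf|/l'f].
    move=> h hd hl; split; [apply: lA|apply: l'A] => // p pl; apply: hl.
      by rewrite mem_cat pl.
    by rewrite mem_cat pl orbT.
  - move=> A A' AA' [l [lf lA]]; exists l; split=> // h hd hl.
    by apply: AA'; exact: lA.
suff /(_ V) : F --> f by apply; exact: open_nbhs_nbhs.
apply/compact_open_cvgP => K O cK oO fKO.
apply: contrapT => hno.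
pose good n := if @unpickle (nat * rat * rat)%type n is Some p
  then if ratr p.1.2 < f (D p.1.1) < ratr p.2 then [:: p] else [::] else [::].
pose l n := flatten [seq good i | i <- iota 0 n].
have lf n : box (l n) f.
  move=> p /flattenP[_ /mapP[i _ ->]]; rewrite /good.
  case: unpickle => // q; case: ifP => // h.
  by rewrite inE => /eqP ->.
have /choice[u hu] n : exists q : (G -> R) * G,
    [/\ Lip1 d q.1, box (l n) q.1, K q.2 & ~ O (q.1 q.2)].
  apply: contrapT => /forallNP hn; apply: hno; exists (l n); split=> // h hd hl.
  move=> _ [k Kk <-]; apply: contrapT => nO; exact: (hn (h, k)).
have Ku n : K (u n).2 by case: (hu n).
have [k Kk hk] := compact_seq_cluster cK Ku.
have [e /= e0 eO] : exists2 e : R, 0 < e & forall r, `|f k - r| < e -> O r.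
  have Ofk : O (f k) by apply: fKO; exists k.
  have /nbhs_ballP[e e0 he] := open_nbhs_nbhs (conj oO Ofk).
  by exists e => // r ?; apply: he.
have e4 : 0 < e / 4 by rewrite divr_gt0.
have [|j /= kj] := hD.2 _ (open_mball dc k (e / 4)).
  by exists k; split=> //=; rewrite (metric_xx dc).
have [q q1 q2] : exists2 q : rat, f (D j) - e / 4 < ratr q & ratr q < f (D j).
  by apply: rat_between; rewrite gtrBl.
have [r r1 r2] : exists2 r : rat, f (D j) < ratr r & ratr r < f (D j) + e / 4.
  by apply: rat_between; rewrite ltrDl.
have [|n nN /= kn] := hk _ (open_mball dc k (e / 4)) _ (pickle (j, q, r)).+1.
  by rewrite /= (metric_xx dc).
have [[_ hd] hbox _ +] := hu n; apply; apply: eO.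
have /hbox/= /andP[h1 h2] : (j, q, r) \in l n.
  apply/flattenP; exists (good (pickle (j, q, r))).
    by apply: map_f; rewrite mem_iota.
  by rewrite /good pickleK /= q2 r1 mem_head.
have := hd (u n).2 (D j); have := fd k (D j).
have := metric_triangular mG (u n).2 k (D j).
rewrite (metric_symmetric mG _ k) !ler_norml ltr_norml.
set s := (u n).1 _ in h1 h2 *; set t := (u n).1 _.
set d1 := d k _ in kn *; set d2 := d k _ in kj *; set d3 := d _ _.
move=> tri /andP[f1 f2] /andP[g1 g2]; apply/andP; split; lra.
Qed.

(** Boxes being countably many, an open set of Lipschitz functions is a
    countable union of boxes. *)
Lemma measurable_map_Lip1 {X : Type} {S : set (set X)}
    (hS : sigma_algebra setT S) (Phi : X -> set_type (Lip1 d)) :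
  (forall g, @measurable_real R X S (fun x => \val (Phi x) g)) ->
  measurable_map S (@borel (set_type (Lip1 d))) Phi.
Proof.
move=> mPhi; apply: sub_generated_sigma.
  split=> [|A SA|A SA].
  - by rewrite preimage_set0; case: hS.
  - rewrite setTD preimage_setC; exact: (sigma_setC hS).
  - by rewrite preimage_bigcup; exact: (sigma_bigcup hS).
move=> _ [V oV <-].
rewrite (_ : _ @^-1` _ = [set x | exists l,
    (forall h, Lip1 d h -> box l h -> V h) /\ box l (\val (Phi x))]).
  apply: (sigma_ex hS) => l.
  apply: (sigma_setI hS); first exact: (sigma_const hS).
  rewrite /box; apply: (sigma_all hS) => p.
  have [pl|pl] := boolP (p \in l); last first.
    rewrite (_ : mkset _ = [set _ | True]); first exact: (sigma_const hS).
    by apply/seteqP; split.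
  rewrite (_ : mkset _ = [set x | ratr p.1.2 < \val (Phi x) (D p.1.1)] `&`
      [set x | \val (Phi x) (D p.1.1) < ratr p.2]).
    apply: (sigma_setI hS); last exact: mPhi.
    exact: (measurable_real_gt hS).
  by apply/seteqP; split=> x /=; [move=> /(_ isT)/andP|move=> [-> ->]].
apply/seteqP; split=> x /=.
  move=> Vx; have Lx : Lip1 d (\val (Phi x)) by exact: set_mem (valP (Phi x)).
  have [l [lx lV]] := compact_open_Lip1_box Lx oV Vx.
  by exists l.
move=> [l [lV lx]]; apply: lV => //; exact: set_mem (valP (Phi x)).
Qed.

End LipschitzBorel.

(** * The embedding *)

Lemma compact_length_ball_exists {R : realType} {G : topologicalGroupType}
    (d : G -> G -> R) : compatible_metric d -> locally_compact [set: G] ->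
  exists eps : R, [/\ 0 < eps, eps <= 1 &
    compact (length_ball (d := d) (3 * eps))].
Proof.
move=> dc Glc; have [r r0 cr] := compact_mball dc Glc 1%g.
have sub s : s <= r -> compact (length_ball (d := d) s).
  move=> sr; rewrite (_ : length_ball s = [set g | d 1%g g <= s]).
    apply: subclosed_compact cr _; first exact: (@closed_mball _ _ _ dc).
    by move=> g /le_trans; exact.
  by apply/funext => g; rewrite /length_ball /= (metric_symmetric dc.1).
exists (Num.min 1 (r / 3)); split.
- by rewrite lt_min ltr01 divr_gt0.
- by rewrite ge_min lexx.
apply: sub; have : Num.min 1 (r / 3) <= r / 3 by rewrite ge_min lexx orbT.
lra.
Qed.

Theorem theorem1p2 (R : realType) (G : topologicalGroupType)
    (Gsc : @second_countable G) (Glc : locally_compact [set: G])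
    (d : G -> G -> R) (dc : compatible_metric d) (dr : right_invariant d)
    (X : Type) (B : set (set X)) (act : G -> X -> X)
    (hX : borel_system R B act) :
  exists Phi : X -> set_type (Lip1 d),
    [/\ injective Phi,
        equivariant act (Lip1_act dr) Phi &
        measurable_map B (@borel (set_type (Lip1 d))) Phi].
Proof.
have hB := standard_borel_sigma_algebra (bs_standard hX).
have [a ha] := orbit_coordinates_exist dc dr Gsc Glc hX.
have [eps [eps0 eps1 ceps]] := compact_length_ball_exists dc Glc.
have [D hD] := @dense_family_exists G setT Gsc (ex_intro _ 1%g I).
pose F := peaks (d := d) (act := act) (a := a) (eps := eps)
  (section_points (d := d) (act := act) (a := a) (eps := eps)).
pose phi x : {compact-open, G -> R} := fun g => F (act g x).
have phiL x : phi x \in Lip1 d.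
  apply/mem_set; split=> [g|g h].
    rewrite /phi (peaks_ge0 dc ha eps0)/=.
    exact: le_trans (peaks_le_eps dc ha eps0 _ _) eps1.
  exact: (peaks_lipschitz dc dr hX ha eps0).
exists (fun x => SigSub (phiL x)); split.
- move=> x y /(congr1 val) /= xy.
  apply: (peaks_injective dc dr hX ha eps0 ceps) => g.
  exact: (congr1 (@^~ g) xy).
- move=> g x; apply: val_inj => /=; apply/funext => h.
  by rewrite /phi /rshift -(bs_actM hX).
apply: (measurable_map_Lip1 dc hD hB) => g /=.
exact: (measurable_real_act dc Gsc Glc hX _
  (peaks_section_measurable dc dr Gsc Glc hX ha eps0 ceps)).
Qed.
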